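(* Let $X,Y$ be Polish spaces and $A,B$ disjoint analytic subsets of $X\times Y$. Then exactly one of the following holds: (a) there is a potentially closed set $D\subseteq X\times Y$ with $A\subseteq D$ and $D\cap B=\emptyset$; (b) there are continuous maps $u:2^\omega\to X$ and $v:2^\omega\to Y$ such that $A_1\subseteq (u\times v)^{-1}(A)$ and $\overline{A_1}\setminus A_1\subseteq (u\times v)^{-1}(B)$. Moreover, this dichotomy becomes false if in (b) the set $\overline{A_1}\setminus A_1$ is replaced by $(2^\omega\times 2^\omega)\setminus A_1$, and it also becomes false if in (b) one additionally requires $u$ and $v$ to be one-to-one.
   Context: Let $\psi:\omega\to 2^{<\omega}$ be the bijection enumerating finite binary sequences by increasing length and, within each length, lexicographically ($\psi(0)=\emptyset,\psi(1)=0,\psi(2)=1,\psi(3)=00,\psi(4)=01,\dots$), so $|\psi(n)|\le n$; put $s_n:=\psi(n)0^{n-|\psi(n)|}$ (so $|s_n|=n$). Define $A_1:=\{(s_n0\gamma,s_n1\gamma): n\in\omega,\ \gamma\in 2^\omega\}\subseteq 2^\omega\times 2^\omega$, and $\overline{A_1}$ its closure. A set $D\subseteq X\times Y$ is potentially closed if there are Polish topologies on $X$ and on $Y$ finer than the original ones making $D$ closed in the product (in particular $D$ is Borel). *)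

(* Defs.v *)
From HB Require Import structures.
From mathcomp Require Import all_boot all_order all_algebra.
From mathcomp Require Import all_classical all_reals all_analysis.

Set Implicit Arguments.
Unset Strict Implicit.
Unset Printing Implicit Defensive.

Local Open Scope classical_set_scope.

(* The library's completeType is pointed, whereas a Polish space may be empty,
   so completeness is stated directly for the Cauchy filters of a metric
   structure [c] on the carrier of [T]. *)
Definition completely_metrizable (R : realType) (T : topologicalType) : Prop :=
  exists c : Metric R T, let M : metricType R := Metric.Pack c in
    @nbhs M M = @nbhs T T /\
    forall F : set_system M, ProperFilter F -> cauchy F -> exists x : M, F --> x.

Definition polish (R : realType) (T : topologicalType) : Prop :=
  (exists2 D : set T, countable D & dense D) /\ completely_metrizable R T.

Definition analytic (R : realType) (Z : topologicalType) (A : set Z) : Prop :=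
  exists P : topologicalType, polish R P /\
  exists2 f : P -> Z, continuous f & range f = A.

(* [cX] and [cY] are new topologies on the carriers of [X] and [Y]. *)
Definition potentially_closed (R : realType) (X Y : topologicalType)
    (D : set (X * Y)) : Prop :=
  exists (cX : Topological X) (cY : Topological Y),
    let X' : topologicalType := Topological.Pack cX in
    let Y' : topologicalType := Topological.Pack cY in
    [/\ polish R X', polish R Y',
        @open X `<=` @open X', @open Y `<=` @open Y' &
        @closed (X' * Y')%type D].

Fixpoint words (l : nat) : seq (seq bool) :=
  if l is k.+1 then map (cons false) (words k) ++ map (cons true) (words k)
  else [:: [::]].

(* The words of length at most n, listed by length and then lexicographically,
   number 2 ^ n.+1 - 1 > n, so the default value of [nth] is never used. *)
Definition psi (n : nat) : seq bool :=
  nth [::] (flatten (map words (iota 0 n.+1))) n.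

Definition sn (n : nat) : seq bool :=
  psi n ++ nseq (n - size (psi n)) false.

Definition prepend (s : seq bool) (g : cantor_space) : cantor_space :=
  fun i : nat => if (i < size s)%N then nth false s i else g (i - size s)%N.

Definition A1 : set (cantor_space * cantor_space) :=
  [set p | exists (n : nat) (g : cantor_space),
     p = (prepend (rcons (sn n) false) g, prepend (rcons (sn n) true) g)].

Definition prod_map (S T X Y : Type) (u : S -> X) (v : T -> Y) (p : S * T) :
    X * Y := (u p.1, v p.2).

Definition exactly_one (P Q : Prop) : Prop := (P /\ ~ Q) \/ (~ P /\ Q).

(* The dichotomy, with its second alternative left as a parameter. *)
Definition dichotomy (R : realType)
    (alt : forall X Y : topologicalType, set (X * Y) -> set (X * Y) -> Prop) :
    Prop :=
  forall X Y : topologicalType, polish R X -> polish R Y ->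
  forall A B : set (X * Y), analytic R A -> analytic R B -> A `&` B = set0 ->
  exactly_one
    (exists D : set (X * Y),
       [/\ potentially_closed R D, A `<=` D & D `&` B = set0])
    (alt X Y A B).

(* Main.v *)
(** Enumerate $B$ analytically and join two points $(x,y), (x',y')$ of $B$ when
    $(x,y') \in A$. Alternative (a) says that $B$ is covered by countably many
    Borel rectangles disjoint from $A$, i.e. that this digraph has a countable
    Borel colouring; since $\overline{A_1} \setminus A_1$ is the diagonal,
    alternative (b) is a continuous homomorphism from $G_0 = A_1$ to it. So the
    dichotomy is of Kechris-Solecki-Todorcevic type. If there is no cover, the
    homomorphism is built by finite approximations, each of which keeps a
    configuration outside of every countable union of Borel rectangles disjoint
    from $A$; when no one-step extension has this property, the values of the
    current configurations at the word [sn n] form an analytic set spanning a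
    rectangle disjoint from $A$, which by Lusin separation lies in a Borel one,
    a contradiction.
    Conversely (a) and (b) exclude each other by Baire category.

    For the first failure take $A_1$ against the diagonal: as $A_1$ is irreflexive
    and antisymmetric, $u(x) = v(y)$ would also hold for $(x,y) \in A_1$. For the
    second, let [spread k] keep the columns before [k] of a point of
    $2^{\omega\times\omega}$ and overwrite the others using only column [k], and
    let $A$ be the union of the graphs of these maps, $B$ the diagonal. An edge
    with label [M > K] preserves all the columns read by [spread K]; hence two
    points joined by such an edge have the same predecessor with label [K], and
    every homomorphism identifies points. *)

From HB Require Import structures.
Require Import Defs.
From mathcomp Require Import all_boot all_order all_algebra.
From mathcomp Require Import all_classical all_reals all_analysis.
From mathcomp Require Import lra.

Set Implicit Arguments.
Unset Strict Implicit.
Unset Printing Implicit Defensive.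

Import Order.TTheory GRing.Theory Num.Theory.

Local Open Scope classical_set_scope.

(** * Codes by sequences of natural numbers *)

(* Polish topologies are handled through codes, i.e. maps to sequences of
   naturals: [g] presents [T] when its range is closed and its inverse is
   continuous, so that pulling back the Baire space along [g] gives a finer
   zero-dimensional Polish topology on [T]. *)
Definition closed_code (I : eqType) (P : Type) (g : P -> I -> nat)
    (S : set P) : Prop :=
  forall z : I -> nat,
    (forall l : seq I, exists2 p, S p & {in l, g p =1 z}) ->
    exists2 p, S p & g p =1 z.

Definition cont_code (I : eqType) (P : Type) (g : P -> I -> nat) (S : set P)
    (T : topologicalType) (f : P -> T) : Prop :=
  forall p V, S p -> nbhs (f p) V ->
    exists l : seq I, forall q, S q -> {in l, g q =1 g p} -> V (f q).

Definition presents (I : eqType) (T : topologicalType) (g : T -> I -> nat) :=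
  closed_code g setT /\ cont_code g setT id.

Definition to_nat (I : countType) (P : Type) (g : P -> I -> nat) :
    P -> nat -> nat :=
  fun p n => if unpickle n is Some i then g p i else 0.

Lemma to_nat_in (I : countType) (P : Type) (g : P -> I -> nat) (l : seq I)
    (p : P) (a : nat -> nat) :
  {in map pickle l, to_nat g p =1 a} <-> {in l, g p =1 a \o pickle}.
Proof.
split=> H i; first by move=> il; rewrite -[RHS]H ?map_f// /to_nat pickleK.
by move=> /mapP[j jl ->]; rewrite /to_nat pickleK H.
Qed.

Lemma closed_code_to_nat (I : countType) (P : Type) (g : P -> I -> nat)
    (S : set P) : closed_code g S -> closed_code (to_nat g) S.
Proof.
move=> cS z zS.
have [l|p Sp pz] := cS (z \o pickle).
  by have [p Sp pz] := zS (map pickle l); exists p => //; exact/to_nat_in.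
exists p => // n; rewrite /to_nat.
case E : (unpickle n) => [i|]; last first.
  have [q _ <-] := zS [:: n]; last by rewrite mem_head.
  by rewrite /to_nat E.
have [r _ H] := zS [:: pickle i; n].
by rewrite pz /= -!H ?inE ?eqxx ?orbT// /to_nat E pickleK.
Qed.

Lemma cont_code_to_nat (I : countType) (P : Type) (g : P -> I -> nat)
    (S : set P) (T : topologicalType) (f : P -> T) :
  cont_code g S f -> cont_code (to_nat g) S f.
Proof.
move=> cf p V Sp pV; have [l lV] := cf p V Sp pV.
exists (map pickle l) => q Sq /to_nat_in H; apply: lV => // i il.
by rewrite H //= /to_nat pickleK.
Qed.

Lemma seq_nat_bound (l : seq nat) : exists n, {subset l <= iota 0 n}.
Proof.
exists (\max_(i <- l) i).+1 => i il; rewrite mem_iota /= add0n ltnS.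
by rewrite (big_rem i)//= leq_maxl.
Qed.

Lemma in_iotaP (T : Type) (n : nat) (a b : nat -> T) :
  {in iota 0 n, a =1 b} <-> forall i, i < n -> a i = b i.
Proof.
split=> H i; first by move=> il; apply: H; rewrite mem_iota.
by rewrite mem_iota /= => /H.
Qed.

Lemma presents_inj (I : eqType) (T : topologicalType) (g : T -> I -> nat) :
  hausdorff_space T -> presents g -> forall x y, g x =1 g y -> x = y.
Proof.
move=> hT [_ cg] x y xy; apply: hT => A B xA yB.
exists y; split; last exact: nbhs_singleton.
by have [l H] := cg x A Logic.I xA; apply: H => // i _; rewrite xy.
Qed.

Section least.

Definition least (P : nat -> Prop) : nat :=
  if pselect (exists n, `[< P n >]) is left e then ex_minn e else 0.

Lemma leastP (P : nat -> Prop) n :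
  P n -> [/\ P (least P), least P <= n & forall m, P m -> least P <= m].
Proof.
move=> Pn; rewrite /least; case: pselect => [e|]; last first.
  by case; exists n; apply/asboolP.
case: ex_minnP => m /asboolP Pm mP.
by split=> //; [apply/mP/asboolP | move=> k Pk; apply/mP/asboolP].
Qed.

Lemma least_eq (P Q : nat -> Prop) N : P N ->
  (forall n, n <= N -> P n <-> Q n) -> least P = least Q.
Proof.
move=> PN PQ; have [P1 lP P2] := leastP PN.
have QN : Q N by apply/PQ.
have [Q1 lQ Q2] := leastP QN.
by apply/eqP; rewrite eqn_leq P2 ?Q2//; apply/PQ.
Qed.

End least.

(* [T] with the topology induced by the code [g]; the field [R] is a parameter
   so that the metric structure can be inferred from the type. *)
Definition coded (R : realType) (T : choiceType) (g : T -> nat -> nat)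
  (g_inj : forall x y, g x =1 g y -> x = y) : Type := T.

Section coded_metric.
Context {R : realType} {T : choiceType} (g : T -> nat -> nat).
Hypothesis g_inj : forall x y, g x =1 g y -> x = y.

Local Open Scope ring_scope.

Definition diff_dist (x y : T) : R :=
  if pselect (exists n, g x n != g y n) is left e then (ex_minn e).+1%:R^-1
  else 0.

Lemma diff_dist_lt x y n :
  diff_dist x y < n.+1%:R^-1 <-> {in iota 0 n.+1, g x =1 g y}.
Proof.
rewrite in_iotaP /diff_dist; case: pselect => [e|e]; last first.
  split=> [_ i _|_]; last by rewrite invr_gt0 ltr0n.
  by apply/eqP/negPn/negP => h; apply: e; exists i.
case: ex_minnP => m gm mP; rewrite ltf_pV2 ?posrE ?ltr0n// ltr_nat ltnS.
split=> [nm i|H].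
  rewrite ltnS => iN; apply/eqP/negPn/negP => /mP.
  by rewrite leqNgt (leq_ltn_trans iN).
by rewrite ltnNge; apply/negP => mn; move: gm; rewrite H ?eqxx// ltnS.
Qed.

Lemma diff_dist_ge0 x y : 0 <= diff_dist x y.
Proof.
by rewrite /diff_dist; case: pselect => // e; rewrite invr_ge0 ler0n.
Qed.

Lemma diff_dist_sym x y : diff_dist x y = diff_dist y x.
Proof.
rewrite /diff_dist; case: pselect => [e|e]; case: pselect => [f|f] //; first last.
- by case: e; have [n] := f; exists n; rewrite eq_sym.
- by case: f; have [n] := e; exists n; rewrite eq_sym.
congr (_.+1%:R^-1); case: ex_minnP => m gm mP; case: ex_minnP => k gk kP.
by apply/eqP; rewrite eqn_leq mP ?kP// eq_sym.
Qed.

Lemma diff_distxx x : diff_dist x x = 0.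
Proof.
by rewrite /diff_dist; case: pselect => // e; have [n] := e; rewrite eqxx.
Qed.

Lemma diff_dist_eq0 x y : diff_dist x y = 0 -> x = y.
Proof.
move=> xy0; apply: g_inj => n.
have /in_iotaP : {in iota 0 n.+1, g x =1 g y}.
  by apply/diff_dist_lt; rewrite xy0 invr_gt0 ltr0n.
exact.
Qed.

Lemma diff_dist_triangle y x z :
  diff_dist x z <= diff_dist x y + diff_dist y z.
Proof.
rewrite {1}/diff_dist; case: pselect => [e|_]; last first.
  by rewrite addr_ge0 ?diff_dist_ge0.
case: ex_minnP => m gm _; rewrite leNgt; apply/negP => lt.
have xy : diff_dist x y < m.+1%:R^-1.
  by rewrite (le_lt_trans _ lt)// lerDl diff_dist_ge0.
have yz : diff_dist y z < m.+1%:R^-1.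
  by rewrite (le_lt_trans _ lt)// lerDr diff_dist_ge0.
move: xy yz => /diff_dist_lt/in_iotaP xy /diff_dist_lt/in_iotaP yz.
by move: gm; rewrite xy// yz// eqxx.
Qed.

HB.instance Definition _ := Choice.on (coded R g_inj).
HB.instance Definition _ := @isMetric.Build R (coded R g_inj) diff_dist
  diff_distxx diff_dist_eq0 diff_dist_sym diff_dist_triangle.

Lemma nbhs_coded (x : coded R g_inj) (V : set (coded R g_inj)) :
  nbhs x V <-> exists n, forall y, {in iota 0 n, g y =1 g x} -> V y.
Proof.
rewrite -(@filter_from_ballE R (coded R g_inj)); split.
  move=> [e /= e0 eV].
  have [n ne] : exists n, n.+1%:R^-1 < e.
    by exists (Num.truncn e^-1); rewrite invf_plt ?posrE// truncnS_gt.
  exists n.+1 => y xy; apply: eV; rewrite ballEmdist /=.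
  by apply: lt_trans ne; apply/diff_dist_lt => i /xy.
move=> [n nV]; exists n.+1%:R^-1 => /=; first by rewrite invr_gt0 ltr0n.
move=> y; rewrite ballEmdist /= => /diff_dist_lt/in_iotaP xy; apply: nV.
by apply/in_iotaP => i iN; rewrite xy// ltnS ltnW.
Qed.

Lemma coded_complete : closed_code g setT ->
  forall F : set_system (coded R g_inj), ProperFilter F -> cauchy F ->
  exists x : coded R g_inj, F --> x.
Proof.
move=> cg F PF /(cauchyP F) cF.
have /choice[x xP] : forall n, exists x : coded R g_inj,
    F [set y | {in iota 0 n.+1, g y =1 g x}].
  move=> n; have [|x Fx] := cF n.+1%:R^-1; first by rewrite invr_gt0 ltr0n.
  exists x; apply: filterS Fx => y; rewrite ballEmdist /=.
  by move=> /diff_dist_lt H i /H.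
pose z n := g (x n) n.
have Fz N : F [set y | {in iota 0 N, g y =1 z}].
  elim: N => [|N IH]; first by apply: filterS filterT => y _ i; rewrite in_nil.
  apply: filterS (filterI IH (xP N)) => y [/in_iotaP yN /in_iotaP yx].
  apply/in_iotaP => i; rewrite ltnS leq_eqVlt => /orP[/eqP ->|]; last exact: yN.
  by rewrite yx.
have [l|y _ yz] := cg z.
  have [N lN] := seq_nat_bound l.
  have [y yz] := filter_ex (Fz N).
  by exists y => // i /lN; exact: yz.
exists y => V /nbhs_coded[n nV].
by apply: filterS (Fz n) => w wz; apply: nV => i /wz ->; rewrite yz.
Qed.

End coded_metric.

Lemma countable_prefix_dense (T : topologicalType) (g : T -> nat -> nat) :
  (forall x V, nbhs x V ->
    exists n, forall y, {in iota 0 n, g y =1 g x} -> V y) ->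
  exists2 D : set T, countable D & dense D.
Proof.
move=> gT.
have /choice[h hP] : forall w : seq nat, exists o : option T,
    forall x, mkseq (g x) (size w) = w ->
    exists2 y, o = Some y & mkseq (g y) (size w) = w.
  move=> w; have [[y yw]|no] := pselect (exists y, mkseq (g y) (size w) = w).
    by exists (Some y) => x _; exists y.
  by exists None => x xw; case: no; exists x.
exists [set x | exists w, h w = Some x].
  apply/countable_injP.
  have /choice[k kP] : forall x : T, exists w,
      (exists w, h w = Some x) -> h w = Some x.
    move=> x; have [[w hw]|no] := pselect (exists w, h w = Some x).
      by exists w.
    by exists [::].
  exists (pickle \o k) => x y /set_mem /= hx /set_mem /= hy.
  move=> /(pcan_inj (@pickleK _)) kxy.
  by apply: Some_inj; rewrite -(kP _ hx) -(kP _ hy) kxy.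
move=> O [x Ox] oO; have [|n nO] := gT x O; first exact: open_nbhs_nbhs.
have [|y hy] := hP (mkseq (g x) n) x; first by rewrite size_mkseq.
rewrite size_mkseq => yx; exists y; split; last by exists (mkseq (g x) n).
apply: nO; apply/in_iotaP => i iN.
by rewrite -(nth_mkseq 0 (g y) iN) yx nth_mkseq.
Qed.

Lemma polish_coded (R : realType) (T : topologicalType) (g : T -> nat -> nat) :
  (forall x y, g x =1 g y -> x = y) -> closed_code g setT ->
  (forall x V, nbhs x V <->
    exists n, forall y, {in iota 0 n, g y =1 g x} -> V y) ->
  polish R T.
Proof.
move=> g_inj cg gT; split.
  by apply: (@countable_prefix_dense _ g) => x V; exact: (gT x V).1.
exists (Metric.class (coded R g_inj)); split; last exact: coded_complete.
by apply/funext => x; apply/funext => V; apply/propext; rewrite gT;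
  exact: nbhs_coded.
Qed.

Lemma polish_hausdorff (R : realType) (T : topologicalType) :
  polish R T -> hausdorff_space T.
Proof.
move=> [_ [c [nbhsE _]]] p q.
rewrite -nbhsE /cluster /= -nbhsE.
exact: (@metric_hausdorff R (Metric.Pack c)).
Qed.

Section polish_code.
Context {R : realType} (M : metricType R) (q : nat -> M).
Hypothesis q_dense : dense (range q).
Hypothesis M_complete :
  forall F : set_system M, ProperFilter F -> cauchy F -> exists x : M, F --> x.

Local Open Scope ring_scope.

Definition radius (n : nat) : R := n.+1%:R^-1.

Lemma radius_gt0 n : 0 < radius n. Proof. by rewrite invr_gt0 ltr0n. Qed.

Lemma radius_small (e : R) : 0 < e -> exists n, radius n < e.
Proof.
move=> e0; exists (Num.truncn e^-1).
by rewrite /radius invf_plt ?posrE// truncnS_gt.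
Qed.

Definition in_ball (p : nat * nat) (x : M) : Prop := mdist x (q p.1) < radius p.2.

Definition nested (p r : nat * nat) : Prop :=
  mdist (q p.1) (q r.1) + radius r.2 < radius p.2.

Let q_close (x : M) (e : R) : 0 < e -> exists k, mdist x (q k) < e.
Proof.
move=> e0; have [||y []] := q_dense (O := (ball x e)°).
- exists x; exact: nbhsx_ballx.
- exact: open_interior.
move=> /interior_subset; rewrite ballEmdist /= => xy [k _ ky].
by exists k; rewrite ky.
Qed.

Let nested_ex p x : in_ball p x -> exists2 r, in_ball r x & nested p r.
Proof.
rewrite /in_ball /nested => px.
pose e := (radius p.2 - mdist x (q p.1)) / 2.
have e0 : 0 < e by rewrite divr_gt0// subr_gt0.
have [m me] := radius_small e0.
have [k kx] := q_close x (radius_gt0 m).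
exists (k, m) => //=.
have := metric_triangle (q p.1) x (q k).
rewrite (metric_sym (q p.1) x); move: me kx; rewrite /e; lra.
Qed.

Definition refines (p : nat * nat) (x : M) (n : nat) : Prop :=
  if unpickle n is Some r then in_ball r x /\ nested p r else False.

(* The least index of a smaller ball around x, rather than the bare bit
   [x \in ball p], is what makes the range of the code closed: the bits alone
   only give a G_delta range. *)
Definition polish_code (x : M) (i : nat * nat + nat) : nat :=
  match i with
  | inl p => if pselect (in_ball p x) then (least (refines p x)).+1 else 0%N
  | inr n => least (fun k => in_ball (k, n) x)
  end.

Let polish_code_eq0 x p : polish_code x (inl p) = 0%N <-> ~ in_ball p x.
Proof. by rewrite /=; case: pselect. Qed.

Let refines_least p x : in_ball p x -> refines p x (least (refines p x)).
Proof.
move=> px; have [r rx pr] := nested_ex px.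
have rp : refines p x (pickle r) by rewrite /refines pickleK.
by have [] := leastP rp.
Qed.

Let least_in_ball n x : in_ball (polish_code x (inr n), n) x.
Proof.
rewrite /=; have [k kx] := q_close x (radius_gt0 n).
by have [] := leastP (P := fun k => in_ball (k, n) x) kx.
Qed.

Lemma polish_code_presents : presents polish_code.
Proof.
split=> [z zP|x V _ xV]; last first.
  have : nbhs x V by [].
  rewrite -(@filter_from_ballE R M) => -[e /= e0 eV].
  have [|n ne] := @radius_small (e / 2); first by rewrite divr_gt0.
  exists [:: inr n] => y _ /(_ (inr n)); rewrite mem_head => /(_ isT) yx.
  apply: eV; rewrite ballEmdist /=.
  have := least_in_ball n x; have := least_in_ball n y.
  rewrite yx /in_ball /= => hy hx.
  have := metric_triangle x (q (polish_code x (inr n))) y.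
  rewrite (metric_sym (q _) y); move: hx hy ne => /=; lra.
pose B (l : seq (nat * nat + nat)) := [set x | {in l, polish_code x =1 z}].
pose F := filter_from setT B.
have PF : ProperFilter F.
  apply: filter_from_proper; last first.
    by move=> l _; have [p _ pz] := zP l; exists p.
  apply: filter_from_filter; first by exists [::].
  move=> l l' _ _; exists (l ++ l') => // x xl.
  by split=> i il; apply: xl; rewrite mem_cat il ?orbT.
have FB l : F (B l) by exists l.
have cF : cauchy F.
  apply/cauchyP => e e0; have [n ne] := radius_small e0.
  exists (q (z (inr n))); exists [:: inr n] => // x xn.
  rewrite ballEmdist /= metric_sym; have := least_in_ball n x.
  by rewrite xn ?mem_head// /in_ball /= => /lt_trans; exact.
have [y Fy] := M_complete PF cF.
have near_y (A : set M) l : nbhs y A -> exists2 x, A x & B l x.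
  by move=> /Fy FA; have [x []] := filter_ex (filterI FA (FB l)); exists x.
have yballE p : in_ball p y <-> z (inl p) <> 0%N.
  split=> [py z0|zn].
    have [|x xA xB] := near_y [set x | in_ball p x] [:: inl p].
    - rewrite -(@filter_from_ballE R M).
      exists (radius p.2 - mdist y (q p.1)); first by rewrite /= subr_gt0.
      move=> x; rewrite ballEmdist /= /in_ball => yx.
      have := metric_triangle x y (q p.1).
      by rewrite (metric_sym x y); move: yx; lra.
    - have : polish_code x (inl p) = 0%N by rewrite xB ?mem_head.
      by move/polish_code_eq0.
  have [r [pr rB]] : exists r, nested p r /\ forall x, B [:: inl p] x -> in_ball r x.
    have [x _ xz] := zP [:: inl p].
    have xp : polish_code x (inl p) = z (inl p) by rewrite xz ?mem_head.
    have px : in_ball p x.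
      by apply: contrapT => /polish_code_eq0; rewrite xp.
    have lx w : in_ball p w -> polish_code w (inl p) = (least (refines p w)).+1.
      by move=> pw /=; case: pselect.
    have := refines_least px; rewrite {1}/refines.
    case E : (unpickle _) => [r|//] [_ pr]; exists r; split=> // w wB.
    have wp : polish_code w (inl p) = z (inl p) by rewrite wB ?mem_head.
    have pw : in_ball p w.
      by apply: contrapT => /polish_code_eq0; rewrite wp.
    have := refines_least pw; rewrite {1}/refines.
    have -> : least (refines p w) = least (refines p x).
      by apply: succn_inj; rewrite -!lx// wp xp.
    by rewrite E => -[].
  rewrite /in_ball.
  have yr : mdist y (q r.1) <= radius r.2.
    rewrite leNgt; apply/negP => lt.
    have [|x xA /rB] := near_y (ball y (mdist y (q r.1) - radius r.2)) [:: inl p].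
      by apply: nbhsx_ballx; rewrite subr_gt0.
    move: xA; rewrite ballEmdist /= /in_ball => h1 h2.
    have := metric_triangle y x (q r.1); move: h1 h2; lra.
  have := metric_triangle y (q r.1) (q p.1).
  rewrite (metric_sym (q r.1)); move: yr pr; rewrite /nested; lra.
have ballE l p x : inl p \in l -> B l x -> in_ball p x <-> in_ball p y.
  move=> pl xB; rewrite yballE -xB//; split; last first.
    by move=> h; apply: contrapT => /polish_code_eq0.
  by move=> px /polish_code_eq0.
exists y => // -[p|n].
  have [py|npy] := pselect (in_ball p y); last first.
    by rewrite (polish_code_eq0 _ _).2//; apply: contrapT => h; apply/npy/yballE/nesym.
  pose N := least (refines p y).
  pose l := inl p :: [seq inl (odflt (0, 0)%N (unpickle n)) | n <- iota 0 N.+1]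
    : seq (nat * nat + nat).
  have [x _ xB] := zP l.
  have px : in_ball p x by apply/(ballE l); rewrite ?mem_head.
  have codeE w : in_ball p w -> polish_code w (inl p) = (least (refines p w)).+1.
    by move=> pw /=; case: pselect.
  rewrite -xB ?mem_head// !codeE//; congr S.
  apply: (@least_eq _ _ N); first exact: refines_least.
  move=> n nN; rewrite /refines; case E : (unpickle n) => [r|//].
  rewrite (ballE l r x)// inE; apply/orP; right; apply/mapP; exists n.
    by rewrite mem_iota.
  by rewrite E.
pose N := polish_code y (inr n).
pose l := inr n :: [seq inl (k, n) | k <- iota 0 N.+1] : seq (nat * nat + nat).
have [x _ xB] := zP l.
rewrite -xB ?mem_head//; apply: (@least_eq _ _ N); first exact: least_in_ball.
move=> k kN; rewrite (ballE l _ x)// inE; apply/orP; right; apply/mapP.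
by exists k => //; rewrite mem_iota.
Qed.

End polish_code.

Lemma polish_presented (R : realType) (T : topologicalType) :
  polish R T -> exists g : T -> nat -> nat, presents g.
Proof.
move=> [[D cD dD] [c [nbhsE cT]]].
have [[x0 _]|T0] := pselect (exists x : T, True); last first.
  exists (fun _ _ => 0); split=> [z /(_ [::])[p]|p]; by case: T0; exists p.
have dx0 : exists x, D x.
  by have [||x []] := dD setT; [exists x0|exact: openT|exists x].
have [d0 Dd0] := dx0.
have [f f_inj] := countable_injP _ cD.
have /choice[q qP] : forall n, exists x, D x /\ forall y, D y -> f y = n -> y = x.
  move=> n; have [[y [Dy fy]]|no] := pselect (exists y, D y /\ f y = n).
    exists y; split=> // w Dw fw; apply: f_inj; rewrite ?inE//.
    by rewrite fw fy.
  by exists d0; split=> // y Dy fy; case: no; exists y.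
pose M : metricType R := Metric.Pack c.
have openE : @open M = @open T.
  apply/funext => A; rewrite !openE; apply/propext.
  by rewrite /interior nbhsE.
have q_dense : @dense M (range q).
  move=> O O0; rewrite openE => oO; have [x [Ox Dx]] := dD O O0 oO.
  by exists x; split=> //; exists (f x) => //; apply/esym; exact: (qP _).2.
have [clo cont] := polish_code_presents q_dense cT.
exists (to_nat (fun x : T => @polish_code R M q x)).
split; first exact: closed_code_to_nat clo.
apply: cont_code_to_nat => p V pT pV; apply: cont => //.
by move: pV; rewrite -nbhsE.
Qed.

(** * Analytic sets and separation *)

Lemma closed_code_sub (I : eqType) (P : Type) (g : P -> I -> nat)
    (S S' : set P) : closed_code g S -> S' `<=` S ->
  (forall p, S p ->
    (forall l : seq I, exists2 q, S' q & {in l, g q =1 g p}) -> S' p) ->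
  closed_code g S'.
Proof.
move=> cS sub H z zP.
have [|p Sp pz] := cS z.
  by move=> l; have [q /sub Sq qz] := zP l; exists q.
exists p => //; apply: H => // l; have [q S'q qz] := zP l.
by exists q => // i il; rewrite pz qz.
Qed.

Lemma cont_code_sub (I : eqType) (P : Type) (g : P -> I -> nat)
    (S S' : set P) (T : topologicalType) (f : P -> T) :
  S' `<=` S -> cont_code g S f -> cont_code g S' f.
Proof.
move=> sub cf p V /sub Sp pV; have [l lV] := cf p V Sp pV.
by exists l => q /sub Sq; exact: lV.
Qed.

Lemma cont_code_comp (I : eqType) (P : Type) (g : P -> I -> nat) (S : set P)
    (T U : topologicalType) (f : P -> T) (h : T -> U) :
  cont_code g S f -> continuous h -> cont_code g S (h \o f).
Proof. by move=> cf ch p V Sp pV; exact: (cf p (h @^-1` V) Sp (ch _ _ pV)). Qed.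

Lemma cont_code_fst (I : eqType) (P : Type) (g : P -> I -> nat) (S : set P)
    (T U : topologicalType) (f : P -> T * U) :
  cont_code g S f -> cont_code g S (fst \o f).
Proof. by move=> cf; apply: cont_code_comp => // x; exact: cvg_fst. Qed.

Lemma cont_code_snd (I : eqType) (P : Type) (g : P -> I -> nat) (S : set P)
    (T U : topologicalType) (f : P -> T * U) :
  cont_code g S f -> cont_code g S (snd \o f).
Proof. by move=> cf; apply: cont_code_comp => // x; exact: cvg_snd. Qed.

(* The closedness of equality, in the only form in which it is used. *)
Lemma hausdorff_limit (P Q : Type) (I J : eqType) (T : topologicalType)
    (g : P -> I -> nat) (h : Q -> J -> nat) (S : set P) (S' : set Q)
    (f : P -> T) (f' : Q -> T) (p : P) (q : Q) :
  hausdorff_space T -> cont_code g S f -> cont_code h S' f' -> S p -> S' q ->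
  (forall (l : seq I) (l' : seq J), exists r s, [/\ S r, S' s,
     {in l, g r =1 g p}, {in l', h s =1 h q} & f r = f' s]) -> f p = f' q.
Proof.
move=> hT cf cf' Sp Sq H; apply: hT => U V pU qV.
have [l lU] := cf _ _ Sp pU; have [l' lV] := cf' _ _ Sq qV.
have [r [s [Sr Ss rp sq rs]]] := H l l'.
by exists (f r); split; [exact: lU|rewrite rs; exact: lV].
Qed.

Definition sum_code (I J : Type) (P : Type) (g : P -> I -> nat)
    (h : P -> J -> nat) : P -> I + J -> nat :=
  fun p i => match i with inl i => g p i | inr j => h p j end.

Lemma in_suml (I J : eqType) (P : Type) (g : P -> I -> nat) (h : P -> J -> nat)
    (l : seq I) p z :
  {in map inl l, sum_code g h p =1 z} -> {in l, g p =1 z \o inl}.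
Proof. by move=> H i il /=; rewrite -H ?map_f. Qed.

Lemma in_sumr (I J : eqType) (P : Type) (g : P -> I -> nat) (h : P -> J -> nat)
    (l : seq J) p z :
  {in map inr l, sum_code g h p =1 z} -> {in l, h p =1 z \o inr}.
Proof. by move=> H i il /=; rewrite -H ?map_f. Qed.

Lemma in_sum (I J : eqType) (P : Type) (g : P -> I -> nat) (h : P -> J -> nat)
    (l : seq I) (l' : seq J) p z :
  {in map inl l ++ map inr l', sum_code g h p =1 z} ->
  {in l, g p =1 z \o inl} /\ {in l', h p =1 z \o inr}.
Proof.
move=> H; split; [apply: (@in_suml _ _ _ g h)|apply: (@in_sumr _ _ _ g h)];
  by move=> i il; apply: H; rewrite mem_cat il ?orbT.
Qed.

Lemma closed_code_prod (I J : eqType) (P Q : Type) (g : P -> I -> nat)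
    (h : Q -> J -> nat) (S : set P) (S' : set Q) :
  closed_code g S -> closed_code h S' ->
  closed_code (sum_code (g \o fst) (h \o snd)) (S `*` S').
Proof.
move=> cS cS' z zP.
have [l|p Sp pz] := cS (z \o inl).
  have [[p q] [/= Sp _] H] := zP (map inl l).
  by exists p => //; exact: (in_suml H).
have [l|q Sq qz] := cS' (z \o inr).
  have [[p' q] [/= _ Sq] H] := zP (map inr l).
  by exists q => //; exact: (in_sumr H).
by exists (p, q) => // -[i|j] /=; [exact: pz|exact: qz].
Qed.

Definition pow_code (K I : Type) (P : Type) (g : P -> I -> nat) :
    (K -> P) -> K * I -> nat :=
  fun x ki => g (x ki.1) ki.2.

Lemma closed_code_pow (K I : eqType) (P : Type) (g : P -> I -> nat)
    (S : set P) : closed_code g S ->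
  closed_code (@pow_code K I P g) [set x | forall k, S (x k)].
Proof.
move=> cS z zP.
have /choice[x xP] : forall k, exists p, S p /\ forall i, g p i = z (k, i).
  move=> k; have [l|p Sp pz] := cS (fun i => z (k, i)); last by exists p.
  have [x xS xz] := zP [seq (k, i) | i <- l].
  exists (x k) => // i il.
  by rewrite -[LHS]/(pow_code g x (k, i)) xz// map_f.
exists x; first by move=> k; have [] := xP k.
by move=> [k i]; have [_] := xP k; exact.
Qed.

Lemma closed_code_pullback (I J : eqType) (P : Type) (T : topologicalType)
    (g : P -> I -> nat) (S : set P) (f : P -> T) (h : T -> J -> nat) :
  hausdorff_space T -> closed_code g S -> cont_code g S f -> presents h ->
  closed_code (sum_code g (h \o f)) S.
Proof.
move=> hT cS cf [ch cid] z zP.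
have [l|p Sp pz] := cS (z \o inl).
  have [p Sp H] := zP (map inl l).
  by exists p => //; exact: (in_suml H).
have [l|x _ xz] := ch (z \o inr).
  have [q Sq H] := zP (map inr l).
  by exists (f q) => //; exact: (in_sumr H).
suff fpx : f p = x by exists p => // -[i|j] /=; rewrite ?pz// fpx xz.
apply: hT => U V pU xV.
have [l lU] := cf _ _ Sp pU; have [l' lV] := cid _ _ Logic.I xV.
have [q Sq H] := zP (map inl l ++ map inr l').
have [ql ql'] := in_sum H.
exists (f q); split; first by apply: lU => // i il; rewrite ql// pz.
by apply: lV => // i il; rewrite xz -ql'.
Qed.

Lemma presents_joint (K J : eqType) (k0 : K) (T : topologicalType)
    (g : K -> T -> J -> nat) : hausdorff_space T -> (forall k, presents (g k)) ->
  presents (fun x ki => g ki.1 x ki.2).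
Proof.
move=> hT gP; split=> [z zP|x V _ xV]; last first.
  have [l lV] := (gP k0).2 x V Logic.I xV.
  exists [seq (k0, i) | i <- l] => y _ yx; apply: lV => // i il.
  exact: (yx (k0, i) (map_f _ il)).
have /choice[x xP] : forall k, exists x, forall i, g k x i = z (k, i).
  move=> k; have [l|x _ xz] := (gP k).1 (fun i => z (k, i)); last by exists x.
  have [x _ xz] := zP [seq (k, i) | i <- l].
  exists x => // i il; exact: (xz (k, i) (map_f _ il)).
exists (x k0) => // -[k i] /=; suff -> : x k0 = x k by exact: xP.
apply: hT => U V xU xV.
have [l lU] := (gP k0).2 _ _ Logic.I xU.
have [l' lV] := (gP k).2 _ _ Logic.I xV.
have [y _ yz] := zP ([seq (k0, i) | i <- l] ++ [seq (k, i) | i <- l']).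
exists y; split.
  apply: lU => // j jl; rewrite xP.
  by apply: (yz (k0, j)); rewrite mem_cat map_f.
apply: lV => // j jl; rewrite xP.
by apply: (yz (k, j)); rewrite mem_cat [X in _ || X]map_f ?orbT.
Qed.

Definition ana (Z : topologicalType) (A : set Z) : Prop :=
  exists (P : Type) (g : P -> nat -> nat) (S : set P) (f : P -> Z),
    [/\ closed_code g S, cont_code g S f & f @` S = A].

Lemma analytic_ana (R : realType) (Z : topologicalType) (A : set Z) :
  analytic R A -> ana A.
Proof.
move=> [P [/polish_presented[g [cg cont]] [f cf <-]]].
by exists P, g, setT, f; split=> //; exact: (cont_code_comp cont cf).
Qed.

Lemma ana_image (Z W : topologicalType) (A : set Z) (h : Z -> W) :
  continuous h -> ana A -> ana (h @` A).
Proof.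
move=> ch [P [g [S [f [cg cf <-]]]]]; exists P, g, S, (h \o f); split=> //.
  exact: cont_code_comp.
by rewrite image_comp.
Qed.

Lemma ana_section (X Y : topologicalType) (A : set (X * Y)) (Q : set Y) :
  hausdorff_space Y -> ana A -> ana Q ->
  ana [set x | exists2 y, Q y & A (x, y)].
Proof.
move=> hY [PA [gA [SA [fA [cA contA <-]]]]] [PQ [gQ [SQ [fQ [cQ contQ <-]]]]].
pose g := sum_code (gA \o fst) (gQ \o snd) : PA * PQ -> _.
pose S := [set pq : PA * PQ | [/\ SA pq.1, SQ pq.2 & (fA pq.1).2 = fQ pq.2]].
have SS : S `<=` SA `*` SQ by move=> pq [].
have cont1 : cont_code g (SA `*` SQ) (fst \o fA \o fst).
  move=> [p q] V [/= Sp Sq] pV.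
  have [l lV] := cont_code_fst contA Sp pV.
  exists (map inl l) => -[p' q'] [/= Sp' _] H.
  by apply: lV => // i il; exact: (in_suml H il).
have cont2 : cont_code g (SA `*` SQ) (snd \o fA \o fst).
  move=> [p q] V [/= Sp Sq] pV.
  have [l lV] := cont_code_snd contA Sp pV.
  exists (map inl l) => -[p' q'] [/= Sp' _] H.
  by apply: lV => // i il; exact: (in_suml H il).
have cont3 : cont_code g (SA `*` SQ) (fQ \o snd).
  move=> [p q] V [/= Sp Sq] qV.
  have [l lV] := contQ _ _ Sq qV.
  exists (map inr l) => -[p' q'] [/= _ Sq'] H.
  by apply: lV => // i il; exact: (in_sumr H il).
have cS : closed_code g S.
  apply: (closed_code_sub (closed_code_prod cA cQ) SS) => pq Spq H.
  split; [exact: Spq.1|exact: Spq.2|].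
  apply: (hausdorff_limit hY cont2 cont3 Spq Spq) => l l'.
  have [r [Sr1 Sr2 Sr] rl] := H (l ++ l'); exists r, r.
  by split=> // i il; apply: rl; rewrite mem_cat il ?orbT.
exists (PA * PQ)%type, (to_nat g), S, (fst \o fA \o fst); split.
- exact: closed_code_to_nat.
- by apply: cont_code_to_nat; exact: cont_code_sub cont1.
apply/seteqP; split=> [x [[p q] [/= Sp Sq pq] <-]|x [y [q Sq qy] [p Sp px]]] /=.
  exists (fQ q); first by exists q.
  by exists p => //; rewrite -pq; case: (fA p).
by exists (p, q); rewrite /S /= px//; split.
Qed.

(* Sets that become clopen in a finer Polish topology; these are the Borel sets,
   but that is never needed. *)
Definition bset (T : topologicalType) (C : set T) : Prop :=
  exists2 g : T -> nat -> nat, presents g &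
    forall x y, g x 0 = g y 0 -> C x -> C y.

Lemma bset_setC (T : topologicalType) (C : set T) : bset C -> bset (~` C).
Proof.
move=> [g gP gC]; exists g => // x y xy nCx Cy; apply: nCx.
exact: (gC y x (esym xy)).
Qed.

Lemma bset_ana (T : topologicalType) (C : set T) : bset C -> ana C.
Proof.
move=> [g [cg cont] gC]; exists T, g, C, id; split; last exact: image_id.
  apply: (closed_code_sub cg) => // p _ /(_ [:: 0])[q Cq qp].
  by apply: gC Cq; exact: (qp 0 (mem_head _ _)).
exact: cont_code_sub cont.
Qed.

Definition open_code (T : Type) (g : T -> nat -> nat) (U : set T) : Prop :=
  forall x, U x -> exists n, forall y, {in iota 0 n, g y =1 g x} -> U y.

Lemma open_code_bset (T : topologicalType) (g : T -> nat -> nat) (U : set T) :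
  presents g -> open_code g U -> bset U.
Proof.
move=> [cg cont] oU.
pose inU x n := forall y, {in iota 0 n, g y =1 g x} -> U y.
pose b x := if pselect (U x) then (least (inU x)).+1 else 0.
have b1 x : U x -> b x = (least (inU x)).+1 by rewrite /b; case: pselect.
have b0 x : ~ U x -> b x = 0 by rewrite /b; case: pselect.
exists (fun x n => if n is m.+1 then g x m else b x); last first.
  move=> x y /= bxy Ux; apply: contrapT => /b0; rewrite -bxy.
  by rewrite b1.
split=> [z zP|x V _ xV]; last first.
  have [l lV] := cont x V Logic.I xV; exists (map S l) => y _ yx.
  by apply: lV => // i il; exact: (yx i.+1 (map_f _ il)).
have [l|p _ pz] := cg (z \o S).
  have [p _ pz] := zP (map S l); exists p => // i il.
  exact: (pz i.+1 (map_f _ il)).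
exists p => // -[|n]; last exact: pz.
have approx n : exists2 q, b q = z 0 & {in iota 0 n, g q =1 g p}.
  have [q _ qz] := zP (0 :: map S (iota 0 n)).
  exists q; first exact: (qz 0 (mem_head _ _)).
  by move=> i il; rewrite pz; apply: (qz i.+1); rewrite inE map_f.
have [Up|nUp] := pselect (U p).
  have [k kP] := oU _ Up.
  have [leastU _ _] := leastP (P := inU p) kP.
  have [q <- qp] := approx (least (inU p)).
  have Uq : U q by exact: leastU.
  rewrite !b1//; congr S; apply: (least_eq leastU) => n nN.
  have E : {in iota 0 n, g q =1 g p}.
    apply/in_iotaP => i iN; move/in_iotaP: qp; apply.
    exact: leq_trans iN nN.
  by split=> H y yq; apply: H => i il; rewrite yq// E.
rewrite b0//; case E : (z 0) => [//|n].
have [q bq qp] := approx n.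
have Uq : U q by apply: contrapT => /b0; rewrite bq E.
have [k kP] := oU _ Uq.
have [leastU _ _] := leastP (P := inU q) kP.
case: nUp; apply: leastU => i il; rewrite qp//.
by move: bq; rewrite b1// E => -[<-].
Qed.

Lemma bset_open (R : realType) (T : topologicalType) (U : set T) :
  polish R T -> open U -> bset U.
Proof.
move=> /polish_presented[g [cg cont]] oU.
apply: (@open_code_bset _ g) => // x Ux.
have [||l lU] := cont x U => //; first exact: open_nbhs_nbhs.
have [n ln] := seq_nat_bound l; exists n => y yx.
by apply: lU => // i /ln; exact: yx.
Qed.

Lemma bset_joint (T : topologicalType) (C : nat -> set T) :
  hausdorff_space T -> (forall n, bset (C n)) ->
  exists2 g : T -> nat -> nat, presents g &
    forall n, exists m, forall x y, g x m = g y m -> C n x -> C n y.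
Proof.
move=> hT CP.
have /choice[h hP] : forall n, exists h : T -> nat -> nat,
    presents h /\ forall x y, h x 0 = h y 0 -> C n x -> C n y.
  by move=> n; have [h hP hC] := CP n; exists h.
have [clo cont] := presents_joint 0 hT (fun n => (hP n).1).
exists (to_nat (fun x (ki : nat * nat) => h ki.1 x ki.2)).
  by split; [exact: closed_code_to_nat|exact: cont_code_to_nat].
move=> n; exists (pickle (n, 0)) => x y.
by rewrite /to_nat pickleK; exact: (hP n).2.
Qed.

Lemma bset_bigcup (T : topologicalType) (C : nat -> set T) :
  hausdorff_space T -> (forall n, bset (C n)) -> bset (\bigcup_n C n).
Proof.
move=> hT /(bset_joint hT)[g gP gC].
apply: (open_code_bset gP) => x [n _ Cnx]; have [m mP] := gC n.
exists m.+1 => y yx; exists n => //; apply: mP Cnx.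
by rewrite yx// mem_iota /= add0n.
Qed.

Section lusin.
Context {Z : topologicalType} (Sigma : set (set Z)).
Hypothesis hZ : hausdorff_space Z.
Hypothesis Sigma_open : forall U, open U -> Sigma U.
Hypothesis Sigma_setC : forall C, Sigma C -> Sigma (~` C).
Hypothesis Sigma_bigcup :
  forall C : nat -> set Z, (forall n, Sigma (C n)) -> Sigma (\bigcup_n C n).

Lemma Sigma_bigcap (C : nat -> set Z) :
  (forall n, Sigma (C n)) -> Sigma (\bigcap_n C n).
Proof.
move=> CS; rewrite -[X in Sigma X]setCK setC_bigcap.
by apply: Sigma_setC; apply: Sigma_bigcup => n; exact: Sigma_setC.
Qed.

Lemma lusin_separation (A B : set Z) : ana A -> ana B -> A `&` B = set0 ->
  exists C, [/\ Sigma C, A `<=` C & C `&` B = set0].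
Proof.
move=> [P [g [S [f [cS cf <-]]]]] [Q [h [S' [f' [cS' cf' <-]]]]] disj.
pose sep n (a b : nat -> nat) := exists C, [/\ Sigma C,
  forall p, S p -> {in iota 0 n, g p =1 a} -> C (f p) &
  forall q, S' q -> {in iota 0 n, h q =1 b} -> ~ C (f' q)].
have [[C [SC C1 C2]]|nsep] := pselect (sep 0 (fun=> 0) (fun=> 0)).
  exists C; split=> //; first by move=> _ [p Sp <-]; apply: (C1 p).
  by apply/seteqP; split=> // x [Cq [q Sq qx]]; apply: (C2 q) => //; rewrite qx.
exfalso.
pose upd (a : nat -> nat) n i m := if m == n then i else a m.
have updP (R : Type) (k : R -> nat -> nat) (r : R) (a : nat -> nat) n :
    {in iota 0 n, k r =1 a} -> {in iota 0 n.+1, k r =1 upd a n (k r n)}.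
  move=> /in_iotaP H; apply/in_iotaP => i; rewrite /upd ltnS leq_eqVlt.
  by case: eqP => [->//|_ /=]; exact: H.
have step n a b : (forall i j, sep n.+1 (upd a n i) (upd b n j)) -> sep n a b.
  move=> H.
  have /choice[C CP] : forall ij : nat * nat, exists C, [/\ Sigma C,
      forall p, S p -> {in iota 0 n.+1, g p =1 upd a n ij.1} -> C (f p) &
      forall q, S' q -> {in iota 0 n.+1, h q =1 upd b n ij.2} -> ~ C (f' q)].
    by move=> ij; exact: H.
  exists (\bigcup_i \bigcap_j C (i, j)); split.
  - apply: Sigma_bigcup => i; apply: Sigma_bigcap => j.
    by have [] := CP (i, j).
  - move=> p Sp pa; exists (g p n) => // j _; have [_ H1 _] := CP (g p n, j).
    by apply: H1 => //; exact: updP.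
  - move=> q Sq qb [i _ /(_ (h q n) Logic.I)]; have [_ _ H2] := CP (i, h q n).
    by apply: H2 => //; exact: updP.
have /choice[next nextP] : forall t : nat * ((nat -> nat) * (nat -> nat)),
    exists ij : nat * nat, ~ sep t.1 t.2.1 t.2.2 ->
      ~ sep t.1.+1 (upd t.2.1 t.1 ij.1) (upd t.2.2 t.1 ij.2).
  move=> [n [a b]] /=; apply: contrapT => /forallNP H.
  apply: (H (0, 0)) => nab; case: nab; apply: step => i j.
  by apply: contrapT => nij; apply: (H (i, j)).
pose t := fix t n : (nat -> nat) * (nat -> nat) := if n is m.+1 then
  let ij := next (m, t m) in (upd (t m).1 m ij.1, upd (t m).2 m ij.2)
  else (fun=> 0, fun=> 0).
have tP n : ~ sep n (t n).1 (t n).2.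
  by elim: n => [//|n IH]; exact: (nextP (n, t n) IH).
pose z i := (t i.+1).1 i; pose w i := (t i.+1).2 i.
have tz n : {in iota 0 n, (t n).1 =1 z}.
  elim: n => [//|n /in_iotaP IH]; apply/in_iotaP => i.
  rewrite ltnS leq_eqVlt => /orP[/eqP->//|iN].
  by rewrite /= /upd (ltn_eqF iN); exact: IH.
have tw n : {in iota 0 n, (t n).2 =1 w}.
  elim: n => [//|n /in_iotaP IH]; apply/in_iotaP => i.
  rewrite ltnS leq_eqVlt => /orP[/eqP->//|iN].
  by rewrite /= /upd (ltn_eqF iN); exact: IH.
have [l|p Sp pz] := cS z.
  have [n ln] := seq_nat_bound l.
  apply: contrapT => H; apply: (tP n); exists set0; split.
  - exact/Sigma_open/open0.
  - move=> p Sp pt; apply: H; exists p => // i /ln il.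
    by rewrite pt//; apply: tz.
  - by move=> q _ _ [].
have [l|q Sq qw] := cS' w.
  have [n ln] := seq_nat_bound l.
  apply: contrapT => H; apply: (tP n); exists setT; split.
  - exact/Sigma_open/openT.
  - by move=> p' _ _.
  - move=> q Sq qt _; apply: H; exists q => // i /ln il.
    by rewrite qt//; exact: tw.
have pq : f p <> f' q.
  move=> pq; have : (f @` S `&` f' @` S') (f p) by split; [exists p|exists q].
  by rewrite disj.
move: hZ; rewrite open_hausdorff => /(_ (f p) (f' q)) [|[U V]]; first exact/eqP.
move=> /= [/set_mem Up /set_mem Vq] [oU oV /eqP UV].
have [l lU] := cf _ _ Sp (open_nbhs_nbhs (conj oU Up)).
have [l' lV] := cf' _ _ Sq (open_nbhs_nbhs (conj oV Vq)).
have [n ln] := seq_nat_bound (l ++ l').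
apply: (tP n); exists U; split; first exact: Sigma_open.
  move=> r Sr rt; apply: lU => // i il.
  have /ln iN : i \in l ++ l' by rewrite mem_cat il.
  by rewrite pz rt// tz.
move=> r Sr rt Ur.
suff : (U `&` V) (f' r) by rewrite UV.
split=> //; apply: lV => // i il.
have /ln iN : i \in l ++ l' by rewrite mem_cat il orbT.
by rewrite qw rt// tw.
Qed.

End lusin.

Lemma bset_separation (R : realType) (T : topologicalType) (A B : set T) :
  polish R T -> ana A -> ana B -> A `&` B = set0 ->
  exists C, [/\ bset C, A `<=` C & C `&` B = set0].
Proof.
move=> pT; have hT := polish_hausdorff pT.
apply: lusin_separation => //.
- by move=> U; exact: bset_open pT.
- by move=> C; exact: bset_setC.
- by move=> C; exact: bset_bigcup.
Qed.

Lemma rectangle_separation (R : realType) (X Y : topologicalType)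
    (A : set (X * Y)) (P : set X) (Q : set Y) : polish R X -> polish R Y ->
  ana A -> ana P -> ana Q -> (P `*` Q) `&` A = set0 ->
  exists C D, [/\ bset C, bset D, P `<=` C, Q `<=` D &
    (C `*` D) `&` A = set0].
Proof.
move=> pX pY aA aP aQ PQA.
have hX := polish_hausdorff pX; have hY := polish_hausdorff pY.
have [C [bC PC CA]] : exists C, [/\ bset C, P `<=` C &
    C `&` [set x | exists2 y, Q y & A (x, y)] = set0].
  apply: bset_separation pX aP (ana_section hY aA aQ) _.
  apply/seteqP; split=> // x [Px [y Qy Axy]].
  by have : (P `*` Q `&` A) (x, y) by []; rewrite PQA.
have aA' : ana [set yx | A (yx.2, yx.1)].
  have -> : [set yx | A (yx.2, yx.1)] = (fun xy : X * Y => (xy.2, xy.1)) @` A.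
    apply/seteqP; split=> [[y x] /= Axy|_ [[x y] Axy <-]] //.
    by exists (x, y).
  by apply: ana_image aA => xy; exact: cvg_pair cvg_snd cvg_fst.
have [D [bD QD DA]] : exists D, [/\ bset D, Q `<=` D &
    D `&` [set y | exists2 x, C x & A (x, y)] = set0].
  apply: bset_separation pY aQ (ana_section hX aA' (bset_ana bC)) _.
  apply/seteqP; split=> // y [Qy [x Cx Axy]].
  have : (C `&` [set x | exists2 y, Q y & A (x, y)]) x by split=> //; exists y.
  by rewrite CA.
exists C, D; split=> //; apply/seteqP; split=> // -[x y] [[/= Cx Dy] Axy].
have : (D `&` [set y | exists2 x, C x & A (x, y)]) y by split=> //; exists x.
by rewrite DA.
Qed.

(** * Covers by rectangles *)

Definition rect_cover (X Y : topologicalType) (A W : set (X * Y)) : Prop :=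
  exists (C : nat -> set X) (D : nat -> set Y),
    [/\ forall n, bset (C n), forall n, bset (D n),
        W = \bigcup_n (C n `*` D n) & W `&` A = set0].

Lemma rect_cover_rect (X Y : topologicalType) (A : set (X * Y)) (C : set X)
    (D : set Y) : bset C -> bset D -> (C `*` D) `&` A = set0 ->
  rect_cover A (C `*` D).
Proof.
move=> bC bD CDA; exists (fun=> C), (fun=> D); split=> //.
by rewrite bigcup_const//; exists 0.
Qed.

Lemma rect_cover_bigcup (X Y : topologicalType) (A : set (X * Y))
    (W : nat -> set (X * Y)) :
  (forall n, rect_cover A (W n)) -> rect_cover A (\bigcup_n W n).
Proof.
move=> WP.
have /choice[CD CDP] : forall n, exists CD : (nat -> set X) * (nat -> set Y),
    [/\ forall k, bset (CD.1 k), forall k, bset (CD.2 k) &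
        W n = \bigcup_k (CD.1 k `*` CD.2 k)].
  by move=> n; have [C [D [bC bD WE _]]] := WP n; exists (C, D).
pose unp m : nat * nat := odflt (0, 0) (unpickle m).
exists (fun m => (CD (unp m).1).1 (unp m).2),
  (fun m => (CD (unp m).1).2 (unp m).2).
split.
- by move=> m; have [] := CDP (unp m).1.
- by move=> m; have [] := CDP (unp m).1.
- apply/seteqP; split=> [p [n _]|p [m _] pm].
    have [_ _ ->] := CDP n => -[k _ pk]; exists (pickle (n, k)) => //.
    by rewrite /unp pickleK.
  by exists (unp m).1 => //; have [_ _ ->] := CDP (unp m).1; exists (unp m).2.
- apply/seteqP; split=> // p [[n _ Wp] Ap].
  have [C [D [_ _ _ WA]]] := WP n.
  by have : (W n `&` A) p by []; rewrite WA.
Qed.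

Lemma rect_coverU (X Y : topologicalType) (A W W' : set (X * Y)) :
  rect_cover A W -> rect_cover A W' -> rect_cover A (W `|` W').
Proof.
move=> WA W'A.
have -> : W `|` W' = \bigcup_n (if n is 0 then W else W').
  apply/seteqP; split=> [p []|p [[|n] _]]; [by exists 0|by exists 1| |].
    by left.
  by right.
by apply: rect_cover_bigcup => -[].
Qed.

Lemma rect_cover0 (X Y : topologicalType) (R : realType) (A : set (X * Y)) :
  polish R X -> polish R Y -> rect_cover A set0.
Proof.
move=> pX pY; rewrite -(setX0 Y setT).
apply: rect_cover_rect; last by rewrite setX0 set0I.
  exact: bset_open pX openT.
exact: bset_open pY open0.
Qed.

Lemma rect_cover_potentially_closed (R : realType) (X Y : topologicalType)
    (A W : set (X * Y)) : polish R X -> polish R Y -> rect_cover A W ->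
  potentially_closed R (~` W).
Proof.
move=> pX pY [C [D [bC bD -> _]]].
have hX := polish_hausdorff pX; have hY := polish_hausdorff pY.
have [gX gXP gXC] := bset_joint hX bC.
have [gY gYP gYD] := bset_joint hY bD.
have iX := presents_inj hX gXP; have iY := presents_inj hY gYP.
exists (Topological.class (coded R iX)), (Topological.class (coded R iY)).
have opn (T : topologicalType) (hT : hausdorff_space T) g (gP : presents g)
    (i : forall x y : T, g x =1 g y -> x = y) (U : set T) :
    open_code g U -> @open (coded R i) U.
  rewrite openE => gU x Ux; apply/nbhs_coded; exact: gU.
have finer (T : topologicalType) (hT : hausdorff_space T) g (gP : presents g)
    (i : forall x y : T, g x =1 g y -> x = y) :
    @open T `<=` @open (coded R i).
  move=> U oU; apply: opn => // x Ux.
  have [||l lU] := gP.2 x U => //; first exact: open_nbhs_nbhs.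
  have [n ln] := seq_nat_bound l; exists n => y yx.
  by apply: lU => // j /ln; exact: yx.
split.
- apply: (@polish_coded R (coded R iX) gX) => //; first exact: gXP.1.
  by move=> x V; exact: nbhs_coded.
- apply: (@polish_coded R (coded R iY) gY) => //; first exact: gYP.1.
  by move=> x V; exact: nbhs_coded.
- exact: finer.
- exact: finer.
apply: open_closedC; apply: bigcup_open => n _.
have openC : @open (coded R iX) (C n).
  apply: opn => // x Cx; have [m mP] := gXC n; exists m.+1 => y yx.
  by apply: mP Cx; rewrite yx// mem_iota /= add0n.
have openD : @open (coded R iY) (D n).
  apply: opn => // x Cx; have [m mP] := gYD n; exists m.+1 => y yx.
  by apply: mP Cx; rewrite yx// mem_iota /= add0n.
rewrite openE => -[x y] [/= Cx Dy]; exists (C n, D n) => //=.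
by split; [exact: (@open_nbhs_nbhs (coded R iX))|
          exact: (@open_nbhs_nbhs (coded R iY))].
Qed.

(** * The homomorphism *)

Lemma finer_in (I J : eqType) (P : Type) (g : P -> I -> nat) (h : P -> J -> nat) :
  (forall i, exists j, forall p, h p j = g p i) ->
  forall l : seq I, exists l' : seq J,
    forall p q, {in l', h p =1 h q} -> {in l, g p =1 g q}.
Proof.
move=> /choice[k kP] l; exists (map k l) => p q H i il.
by rewrite -!kP; apply: H; exact: map_f.
Qed.

Lemma finer_cont (I J : eqType) (P : Type) (g : P -> I -> nat)
    (h : P -> J -> nat) (S : set P) (T : topologicalType) (f : P -> T) :
  (forall i, exists j, forall p, h p j = g p i) ->
  cont_code g S f -> cont_code h S f.
Proof.
move=> gh cf p V Sp pV; have [l lV] := cf p V Sp pV.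
have [l' l'P] := finer_in gh l; exists l' => q Sq qp.
by apply: lV => //; exact: l'P.
Qed.

Section avoid.
Context {X Y : topologicalType} (hX : hausdorff_space X) (hY : hausdorff_space Y).
Context (A W : set (X * Y)) (PB : Type) (gB : PB -> nat -> nat) (SB : set PB)
  (fB : PB -> X * Y).
Hypothesis cB : closed_code gB SB.
Hypothesis contB : cont_code gB SB fB.

Lemma avoid_code : rect_cover A W ->
  exists2 h : PB -> nat -> nat,
    closed_code h (SB `&` [set p | ~ W (fB p)]) &
    forall i, exists j, forall p, h p j = gB p i.
Proof.
move=> [C [D [bC bD -> _]]].
have [gX gXP gXC] := bset_joint hX bC.
have [gY gYP gYD] := bset_joint hY bD.
pose h1 := sum_code gB (gX \o (fst \o fB)).
pose h := sum_code h1 (gY \o (snd \o fB)).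
have c1 : closed_code h1 SB.
  by apply: closed_code_pullback => //; exact: cont_code_fst.
have c2 : closed_code h SB.
  apply: closed_code_pullback => //.
  by apply: (@finer_cont _ _ _ gB); [move=> i; exists (inl i)|exact: cont_code_snd].
exists (to_nat h); last first.
  move=> i; exists (pickle (inl (inl i) : nat + nat + nat)) => p.
  by rewrite /to_nat pickleK.
apply: closed_code_to_nat; apply: (closed_code_sub c2); first by move=> p [].
move=> p Sp H; split=> // -[n _ [Cp Dp]].
have [m mP] := gXC n; have [k kP] := gYD n.
have [q [Sq nq] qp] := H [:: inl (inr m); inr k].
apply: nq; exists n => //; split.
  by apply: mP Cp; apply/esym/(qp (inl (inr m))); exact: mem_head.
by apply: kP Dp; apply/esym/(qp (inr k)); rewrite !inE eqxx orbT.
Qed.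

End avoid.

Lemma words_mem (s : seq bool) : s \in words (size s).
Proof.
elim: s => [|b s IH] /=; rewrite ?mem_cat; first by rewrite mem_head.
by case: b; rewrite map_f ?orbT.
Qed.

Lemma words_size l (s : seq bool) : s \in words l -> size s = l.
Proof.
elim: l s => [|l IH] s /=; first by rewrite inE => /eqP ->.
by rewrite mem_cat => /orP[] /mapP[t /IH <- ->].
Qed.

Lemma mkseq_eq (T : eqType) (f g : nat -> T) n :
  mkseq f n = mkseq g n <-> {in iota 0 n, f =1 g}.
Proof. by split=> [/eq_in_map|H] //; exact/eq_in_map. Qed.

Lemma nbhs_cantor (a : cantor_space) (V : set cantor_space) :
  nbhs a V <-> exists n, forall b : cantor_space, {in iota 0 n, b =1 a} -> V b.
Proof.
split=> [aV|[n nV]]; last first.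
  suff H : nbhs a [set b : cantor_space | {in iota 0 n, b =1 a}].
    by apply: filterS H.
  elim: n {nV} => [|n IH]; first by apply: filterS filterT => b _ i; rewrite in_nil.
  have : nbhs a ((fun b : cantor_space => b n) @^-1` [set a n]).
    by apply: (@proj_continuous nat (fun=> bool) n a); exact: discrete_set1.
  move=> /(filterI IH); apply: filterS => b [/in_iotaP bn bna]; apply/in_iotaP => i.
  by rewrite ltnS leq_eqVlt => /orP[/eqP ->|] //; exact: bn.
apply: contrapT => /forallNP noV.
have /choice[b bP] : forall n, exists b : cantor_space,
    {in iota 0 n, b =1 a} /\ ~ V b.
  move=> n; apply: contrapT => /forallNP H; apply: (noV n) => b bn.
  by apply: contrapT => nVb; apply: (H b).
have bcvg : b @ \oo --> a.
  apply/cvg_sup => N U [Q] [[W oW <-] WfN WU].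
  apply: (filterS WU); rewrite nbhs_simpl; exists N.+1 => // i /= Ni.
  by have [/in_iotaP H _] := bP i; rewrite /= H.
by have [N _ /(_ N (leqnn _))] := bcvg _ aV; have [] := bP N.
Qed.

Lemma mkseqD (T : Type) (a : nat -> T) m n :
  mkseq a (m + n) = mkseq a m ++ mkseq (fun i => a (m + i)) n.
Proof.
rewrite /mkseq iotaD map_cat add0n; congr cat.
by rewrite -{1}(addn0 m) iotaDl -map_comp.
Qed.

Lemma size_psi n : size (psi n) <= n.
Proof.
rewrite /psi; set L := flatten _.
have [nL|Ln] := ltnP n (size L); last by rewrite nth_default.
have /flattenP[w /mapP[l]] := mem_nth [::] nL.
by rewrite mem_iota add0n ltnS => /= ln -> /words_size ->.
Qed.

Lemma size_sn n : size (sn n) = n.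
Proof. by rewrite /sn size_cat size_nseq subnKC// size_psi. Qed.

Lemma mkseq_prepend (s : seq bool) (g : cantor_space) n :
  mkseq (prepend s g) (size s + n) = s ++ mkseq g n.
Proof.
rewrite mkseqD; congr cat.
  apply: (@eq_from_nth _ false); rewrite size_mkseq// => i iN.
  by rewrite nth_mkseq// /prepend iN.
by apply: eq_mkseq => i; rewrite /prepend ltnNge leq_addr /= addKn.
Qed.

Section chain.
Context {R : realType} {X Y : topologicalType} (pX : polish R X) (pY : polish R Y).
Context (PA : Type) (gA : PA -> nat -> nat) (SA : set PA) (fA : PA -> X * Y).
Context (PB : Type) (gB : PB -> nat -> nat) (SB : set PB) (fB : PB -> X * Y).
Hypotheses (cA : closed_code gA SA) (contA : cont_code gA SA fA).
Hypotheses (cB : closed_code gB SB) (contB : cont_code gB SB fB).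

Let hX := polish_hausdorff pX.
Let hY := polish_hausdorff pY.
Let A := fA @` SA.

(* A configuration of level [n] is a copy in [B] of the graph that G_0 induces
   on the words of length [n]: [c.1 s] is the image of the word [s] and
   [c.2 (k, t)] a witness in [A] for the edge from [sn k 0 t] to [sn k 1 t].
   Values at words of other lengths are irrelevant. *)
Definition config : Type := ((seq bool -> PB) * (nat * seq bool -> PA))%type.

Definition config_index : eqType := ((seq bool * nat) + (nat * seq bool) * nat)%type.

Definition config_code (g : PB -> nat -> nat) : config -> config_index -> nat :=
  sum_code (@pow_code (seq bool) nat PB g \o fst)
           (@pow_code (nat * seq bool)%type nat PA gA \o snd).

Definition config_points (S : set PB) : set config :=
  [set x | forall s, S (x s)] `*` [set w | forall k, SA (w k)].

Definition config_half (b : bool) (c : config) : config :=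
  (fun s => c.1 (rcons s b), fun kt => c.2 (kt.1, rcons kt.2 b)).

Definition config_edge (n : nat) (c : config) : Prop :=
  fA (c.2 (n, [::])) = ((fB (c.1 (rcons (sn n) false))).1,
                        (fB (c.1 (rcons (sn n) true))).2).

Definition config_edges (n : nat) : seq (nat * seq bool) :=
  [seq (k, t) | k <- iota 0 n, t <- words (n - k.+1)].

Definition config_key (n : nat) (c : config) : seq (seq nat) * seq (seq nat) :=
  ([seq mkseq (gB (c.1 s)) n | s <- words n],
   [seq mkseq (gA (c.2 kt)) n | kt <- config_edges n]).

Definition extension (n : nat) (K : set config)
    (kappa : seq (seq nat) * seq (seq nat)) :
    set config :=
  [set c | [/\ config_points SB c, K (config_half false c),
               K (config_half true c), config_edge n c &
               config_key n.+1 c = kappa]].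

Definition relclosed (K : set config) : Prop :=
  K `<=` config_points SB /\
  forall c, config_points SB c ->
    (forall l : seq config_index,
      exists2 c', K c' & {in l, config_code gB c' =1 config_code gB c}) ->
    K c.

Definition large (K : set config) : Prop :=
  forall W, rect_cover A W -> exists2 c, K c & forall s, ~ W (fB (c.1 s)).

Lemma cont_x (T : topologicalType) (f : PB -> T) s :
  cont_code gB SB f ->
  cont_code (config_code gB) (config_points SB) (fun c => f (c.1 s)).
Proof.
move=> cf c V [Sc _] cV; have [l lV] := cf _ _ (Sc s) cV.
exists [seq inl (s, i) | i <- l] => c' [Sc' _] H; apply: lV => // i il.
exact: (H (inl (s, i)) (map_f _ il)).
Qed.

Lemma cont_w (T : topologicalType) (f : PA -> T) k :
  cont_code gA SA f ->
  cont_code (config_code gB) (config_points SB) (fun c => f (c.2 k)).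
Proof.
move=> cf c V [_ Sc] cV; have [l lV] := cf _ _ (Sc k) cV.
exists [seq inr (k, i) | i <- l] => c' [_ Sc'] H; apply: lV => // i il.
exact: (H (inr (k, i)) (map_f _ il)).
Qed.

Lemma config_points_half b c : config_points SB c -> config_points SB (config_half b c).
Proof. by move=> [/= Sx Sw]; split=> /= ?. Qed.

Lemma extension_relclosed n K kappa :
  relclosed K -> relclosed (extension n K kappa).
Proof.
move=> [KS Kcl]; split=> [c []//|c Sc H].
have Khalf b : K (config_half b c).
  apply: Kcl; first exact: config_points_half.
  move=> l; pose sh (i : config_index) : config_index := match i with
    | inl (s, i) => inl (rcons s b, i)
    | inr ((k, t), i) => inr ((k, rcons t b), i) end.
  have [c' [_ K0 K1 _ _] Hc'] := H (map sh l).
  exists (config_half b c'); first by case: (b).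
  by move=> i il; have := Hc' _ (map_f sh il); case: i il => [[s i]|[[k t] i]].
split=> //.
- have appr (l l' : seq config_index) : exists r, [/\ config_points SB r,
      {in l, config_code gB r =1 config_code gB c},
      {in l', config_code gB r =1 config_code gB c} &
      config_edge n r].
    have [r [? ? ? ? ?] rc] := H (l ++ l'); exists r.
    by split=> // i il; apply: rc; rewrite mem_cat il ?orbT.
  rewrite /config_edge [LHS]surjective_pairing; congr pair.
    have lim := (hausdorff_limit hX (cont_w (k := (n, [::])) (cont_code_fst contA))
      (cont_x (s := rcons (sn n) false) (cont_code_fst contB)) Sc Sc).
    apply: lim => l l'.
    have [r [Sr rc rc' re]] := appr l l'.
    by exists r, r; split=> //=; rewrite re.
  have lim := (hausdorff_limit hY (cont_w (k := (n, [::])) (cont_code_snd contA))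
    (cont_x (s := rcons (sn n) true) (cont_code_snd contB)) Sc Sc).
  apply: lim => l l'.
  have [r [Sr rc rc' re]] := appr l l'.
  by exists r, r; split=> //=; rewrite re.
pose l1 : seq config_index :=
  [seq inl (s, i) | s <- words n.+1, i <- iota 0 n.+1].
pose l2 : seq config_index :=
  [seq inr (kt, i) | kt <- config_edges n.+1, i <- iota 0 n.+1].
have [c' [_ _ _ _ <-] Hc'] := H (l1 ++ l2).
congr pair; apply/eq_in_map => s sl; apply/mkseq_eq => i il.
  apply/esym/(Hc' (inl (s, i))); rewrite mem_cat; apply/orP; left.
  exact: allpairs_f.
apply/esym/(Hc' (inr (s, i))); rewrite mem_cat; apply/orP; right.
exact: allpairs_f.
Qed.

Lemma config_code_finer (g : PB -> nat -> nat) :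
  (forall i, exists j, forall p, g p j = gB p i) ->
  forall i, exists j, forall c, config_code g c j = config_code gB c i.
Proof.
move=> H [[s i]|k]; last by exists (inr k).
by have [j jP] := H i; exists (inl (s, j)) => c; exact: jP.
Qed.

Lemma ana_values K W s : relclosed K -> rect_cover A W ->
  ana [set fB (c.1 s) | c in K `&` [set c | forall s, ~ W (fB (c.1 s))]].
Proof.
move=> [KS Kcl] WA.
have [g cg fg] := avoid_code hX hY cB contB WA.
have cfg := closed_code_prod (closed_code_pow (K := seq bool) cg)
  (closed_code_pow (K := (nat * seq bool)%type) cA).
have sub : K `&` [set c | forall s, ~ W (fB (c.1 s))] `<=`
    config_points (SB `&` [set p | ~ W (fB p)]).
  by move=> c [/KS[Sx Sw] nW]; split=> //= t; split=> //; exact: nW.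
exists config, (to_nat (config_code g)),
  (K `&` [set c | forall s, ~ W (fB (c.1 s))]),
  (fun c => fB (c.1 s)); split=> //.
- apply: closed_code_to_nat; apply: (closed_code_sub cfg sub).
  move=> c [/= Sx Sw] H; split; last by move=> t; have [] := Sx t.
  apply: Kcl; first by split=> //= t; have [] := Sx t.
  move=> l; have [l' l'P] := finer_in (config_code_finer fg) l.
  by have [c' [Kc' _] c'c] := H l'; exists c' => //; exact: l'P.
- apply: cont_code_to_nat; apply: (finer_cont (config_code_finer fg)).
  by apply: cont_code_sub (cont_x (s := s) contB); move=> c [/KS].
Qed.

Lemma half_onto c0 c1 q : exists2 c : config,
  config_half false c = c0 /\ config_half true c = c1 &
  c.1 [::] = c1.1 [::] /\ forall k, c.2 (k, [::]) = q.
Proof.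
pose cb (b : bool) := if b then c1 else c0.
pose c : config := (fun s => (cb (last true s)).1 (take (size s).-1 s),
  fun kt => if kt.2 == [::] then q
            else (cb (last true kt.2)).2 (kt.1, take (size kt.2).-1 kt.2)).
have takeE (s : seq bool) b : take (size (rcons s b)).-1 (rcons s b) = s.
  by rewrite size_rcons /= -cats1 take_size_cat.
have H b : config_half b c = cb b.
  rewrite [RHS]surjective_pairing; congr pair; apply/funext.
    by move=> s /=; rewrite takeE last_rcons.
  by move=> [k t] /=; rewrite takeE last_rcons; case: t.
by exists c; split=> //.
Qed.

(* If no extension is large, the values at the word [sn n] of the configurations
   avoiding the union of the bad covers span a rectangle disjoint from [A]. *)
Lemma extension_large n K : relclosed K -> large K ->
  exists kappa, large (extension n K kappa).
Proof.
move=> Kcl Kg; apply: contrapT => /forallNP bad.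
have /choice[W WP] : forall kappa, exists W, rect_cover A W /\
    forall c, extension n K kappa c -> exists s, W (fB (c.1 s)).
  move=> kappa; apply: contrapT => /forallNP noW; apply: (bad kappa) => W WA.
  apply: contrapT => noc; apply: (noW W); split=> // c Kc.
  apply: contrapT => /forallNP nos; apply: noc; exists c => // s; exact: nos.
pose Wn m := if unpickle m is Some kappa then W kappa else set0.
have UA : rect_cover A (\bigcup_m Wn m).
  apply: rect_cover_bigcup => m; rewrite /Wn; case: unpickle => [kappa|].
    by have [] := WP kappa.
  exact: (rect_cover0 A pX pY).
set U := \bigcup_m Wn m in UA.
have aS := ana_values (sn n) Kcl UA; set S0 := (X in ana X) in aS.
have aA : ana A by exists PA, gA, SA, fA.
have [E|/eqP/set0P] := pselect ((fst @` S0 `*` snd @` S0) `&` A = set0).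
  have a1 : ana (fst @` S0) by apply: ana_image aS => xy; exact: cvg_fst.
  have a2 : ana (snd @` S0) by apply: ana_image aS => xy; exact: cvg_snd.
  have [C [D [bC bD SC SD CDA]]] := rectangle_separation pX pY aA a1 a2 E.
  have [c Kc nW] := Kg _ (rect_coverU UA (rect_cover_rect bC bD CDA)).
  apply: (nW (sn n)); right.
  have Sc : S0 (fB (c.1 (sn n))).
    by exists c => //; split=> // s cU; apply: (nW s); left.
  by split; [apply: SC|apply: SD]; exists (fB (c.1 (sn n))).
move=> [[x y] [[/= [_ [c0 [K0 nU0] <-] <-] [_ [c1 [K1 nU1] <-] <-]] [q Sq qE]]].
have [c [h0 h1] [hn hq]] := half_onto c0 c1 q.
have x0 s : c.1 (rcons s false) = c0.1 s by rewrite -h0.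
have x1 s : c.1 (rcons s true) = c1.1 s by rewrite -h1.
have w0 k t : c.2 (k, rcons t false) = c0.2 (k, t) by rewrite -h0.
have w1 k t : c.2 (k, rcons t true) = c1.2 (k, t) by rewrite -h1.
have Kc : extension n K (config_key n.+1 c) c.
  split=> //; rewrite ?h0 ?h1//.
  - have [S0x S0w] := Kcl.1 _ K0; have [S1x S1w] := Kcl.1 _ K1.
    split=> /=.
      elim/last_ind => [|s [] _]; rewrite ?hn ?x0 ?x1//.
    by move=> [k t]; elim/last_ind: t => [|t [] _]; rewrite ?hq ?w0 ?w1.
  - by rewrite /config_edge hq x0 x1 qE.
have [s] := (WP (config_key n.+1 c)).2 c Kc.
have inU p : W (config_key n.+1 c) p -> U p.
  by exists (pickle (config_key n.+1 c)) => //; rewrite /Wn pickleK.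
by elim/last_ind: s => [|s [] _] /inU; rewrite ?hn ?x0 ?x1;
  [exact: nU1|exact: nU1|exact: nU0].
Qed.
Definition config_shift (t : seq bool) (c : config) : config :=
  (fun s => c.1 (s ++ t), fun kt => c.2 (kt.1, kt.2 ++ t)).

Section limit.
Context (K : nat -> set config) (kappa : nat -> seq (seq nat) * seq (seq nat)).
Hypothesis K0 : K 0 `<=` config_points SB.
Hypothesis KS : forall n, K n.+1 = extension n (K n) (kappa n).

Lemma shift_chain t n c : K (size t + n) c -> K n (config_shift t c).
Proof.
elim/last_ind: t c => [|t b IH] c.
  suff -> : config_shift [::] c = c by [].
  rewrite [RHS]surjective_pairing; congr pair; apply/funext.
    by move=> s /=; rewrite cats0.
  by move=> [k t] /=; rewrite cats0.
rewrite size_rcons addSn KS => -[_ Kf Kt _ _].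
have /IH : K (size t + n) (config_half b c) by case: b.
suff -> : config_shift t (config_half b c) = config_shift (rcons t b) c by [].
by congr pair; apply/funext; [move=> s|move=> [k s]]; rewrite /= rcons_cat.
Qed.

Lemma chain_points n c : K n c -> config_points SB c.
Proof. by case: n => [/K0//|n]; rewrite KS => -[]. Qed.

Lemma chain_edge k t c : K (size t + k.+1) c ->
  fA (c.2 (k, t)) = ((fB (c.1 (rcons (sn k) false ++ t))).1,
                     (fB (c.1 (rcons (sn k) true ++ t))).2).
Proof. by move=> /shift_chain; rewrite KS => -[_ _ _]. Qed.

Lemma chain_key n t t' c c' : K (size t + n.+1) c -> K (size t' + n.+1) c' ->
  config_key n.+1 (config_shift t c) = config_key n.+1 (config_shift t' c').
Proof.
by move=> /shift_chain + /shift_chain; rewrite !KS => -[_ _ _ _ ->] [_ _ _ _ ->].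
Qed.

Lemma chain_x (a : nat -> bool) m m' c c' i : K m c -> K m' c' ->
  i < m -> i < m' -> gB (c.1 (mkseq a m)) i = gB (c'.1 (mkseq a m')) i.
Proof.
move=> Kc Kc' im im'.
pose t k := mkseq (fun j => a (i.+1 + j)) (k - i.+1).
have tE k : i < k -> mkseq a k = mkseq a i.+1 ++ t k.
  by move=> ik; rewrite -mkseqD subnKC.
have st k : i < k -> size (t k) + i.+1 = k.
  by move=> ik; rewrite size_mkseq subnK.
have := @chain_key i (t m) (t m') c c'; rewrite !st// => /(_ Kc Kc')[/eq_in_map H _].
have wi : mkseq a i.+1 \in words i.+1.
  by have := words_mem (mkseq a i.+1); rewrite size_mkseq.
by have := H _ wi => /mkseq_eq/in_iotaP/(_ _ (ltnSn i));
  rewrite (tE _ im) (tE _ im').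
Qed.

Lemma chain_w (a : nat -> bool) k m m' c c' i :
  K (m + k.+1) c -> K (m' + k.+1) c' ->
  i <= m -> i <= m' ->
  {in iota 0 i, gA (c.2 (k, mkseq a m)) =1 gA (c'.2 (k, mkseq a m'))}.
Proof.
move=> Kc Kc' im im'.
pose t l := mkseq (fun j => a (i + j)) (l - i).
have tE l : i <= l -> mkseq a l = mkseq a i ++ t l.
  by move=> il; rewrite -mkseqD subnKC.
have st l : i <= l -> size (t l) + (i + k).+1 = l + k.+1.
  by move=> il; rewrite size_mkseq -addnS addnA subnK.
have := @chain_key (i + k) (t m) (t m') c c'.
rewrite !st// => /(_ Kc Kc')[_ /eq_in_map H].
have := H (k, mkseq a i); rewrite /= -!tE// => E.
have kt : (k, mkseq a i) \in config_edges (i + k).+1.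
  apply/allpairsPdep; exists k, (mkseq a i); split=> //.
    by rewrite mem_iota /= add0n ltnS leq_addl.
  by have := words_mem (mkseq a i); rewrite size_mkseq subSS addnK.
move: (E kt) => /mkseq_eq/in_iotaP h; apply/in_iotaP => j ji.
by apply: h; rewrite (leq_trans ji)// -addnS leq_addr.
Qed.

Lemma limit_hom : (forall n, K n !=set0) ->
  exists (u : cantor_space -> X) (v : cantor_space -> Y),
    [/\ continuous u, continuous v, forall a, (fB @` SB) (u a, v a) &
        forall k g, A (u (prepend (rcons (sn k) false) g),
                       v (prepend (rcons (sn k) true) g))].
Proof.
move=> /choice[c Kc].
pose z (a : nat -> bool) i := gB ((c i.+1).1 (mkseq a i.+1)) i.
have xz (a : nat -> bool) n : {in iota 0 n, gB ((c n).1 (mkseq a n)) =1 z a}.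
  by apply/in_iotaP => i iN; exact: chain_x.
have cx s n : SB ((c n).1 s) by have [] := chain_points (Kc n).
have cw kt n : SA ((c n).2 kt) by have [] := chain_points (Kc n).
have /choice[p pP] : forall a : cantor_space, exists p, SB p /\ gB p =1 z a.
  move=> a; have [l|p Sp pz] := cB (z := z a); last by exists p.
  have [n ln] := seq_nat_bound l.
  by exists ((c n).1 (mkseq a n)) => // i /ln; exact: xz.
have contp (T : topologicalType) (f : PB -> T) :
    cont_code gB SB f -> continuous (f \o p).
  move=> cf a V aV; have [l lV] := cf _ _ (pP a).1 aV.
  have [n ln] := seq_nat_bound l.
  apply/nbhs_cantor; exists n => b ba; apply: lV; first exact: (pP b).1.
  move=> i /ln iN; rewrite (pP a).2 (pP b).2 /z.
  congr (gB (_ _) i); apply/mkseq_eq/in_iotaP => j ji.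
  move/in_iotaP: ba; apply; rewrite (leq_trans ji)//.
  by move: iN; rewrite mem_iota.
exists (fst \o fB \o p), (snd \o fB \o p); split.
- by apply: contp; exact: cont_code_fst.
- by apply: contp; exact: cont_code_snd.
- by move=> a; exists (p a); [exact: (pP a).1|exact: surjective_pairing].
move=> k g.
pose y i := gA ((c (i.+1 + k.+1)).2 (k, mkseq g i.+1)) i.
have wy n : {in iota 0 n, gA ((c (n + k.+1)).2 (k, mkseq g n)) =1 y}.
  apply/in_iotaP => i iN.
  have /in_iotaP := @chain_w g k n i.+1 _ _ i.+1
    (Kc (n + k.+1)) (Kc (i.+1 + k.+1)) iN (leqnn _).
  by move=> /(_ _ (ltnSn i)).
have [l|q Sq qy] := cA (z := y).
  have [n ln] := seq_nat_bound l.
  by exists ((c (n + k.+1)).2 (k, mkseq g n)) => // i /ln; exact: wy.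
exists q => //; rewrite [LHS]surjective_pairing.
set a0 := prepend _ g; set a1 := prepend _ g.
have pre b n : mkseq (prepend (rcons (sn k) b) g) (n + k.+1) =
    rcons (sn k) b ++ mkseq g n.
  by rewrite -mkseq_prepend size_rcons size_sn addnC.
have appr (l l' : seq nat) : exists n, [/\
    {in l, gA ((c (n + k.+1)).2 (k, mkseq g n)) =1 gA q},
    {in l', gB ((c (n + k.+1)).1 (mkseq a0 (n + k.+1))) =1 gB (p a0)},
    {in l', gB ((c (n + k.+1)).1 (mkseq a1 (n + k.+1))) =1 gB (p a1)} &
    fA ((c (n + k.+1)).2 (k, mkseq g n)) =
      ((fB ((c (n + k.+1)).1 (mkseq a0 (n + k.+1)))).1,
       (fB ((c (n + k.+1)).1 (mkseq a1 (n + k.+1)))).2)].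
  have [n ln] := seq_nat_bound (l ++ l').
  have ln' i : i \in l' -> i \in iota 0 (n + k.+1).
    move=> il; have : i \in iota 0 n by apply: ln; rewrite mem_cat il orbT.
    by rewrite !mem_iota !add0n /= => /leq_trans; apply; rewrite leq_addr.
  exists n; split.
  - by move=> i il; rewrite qy wy// ln// mem_cat il.
  - by move=> i /ln' iN; rewrite (pP _).2 xz.
  - by move=> i /ln' iN; rewrite (pP _).2 xz.
  - by rewrite chain_edge ?size_mkseq// /a0 /a1 !pre.
congr pair.
  have lim := hausdorff_limit hX (cont_code_fst contA)
    (cont_code_fst contB) Sq (pP a0).1.
  apply: lim => l l'; have [n [h1 h2 _ h3]] := appr l l'.
  by exists ((c (n + k.+1)).2 (k, mkseq g n)),
    ((c (n + k.+1)).1 (mkseq a0 (n + k.+1)));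
    split=> //=; rewrite h3.
have lim := hausdorff_limit hY (cont_code_snd contA)
  (cont_code_snd contB) Sq (pP a1).1.
apply: lim => l l'; have [n [h1 _ h2 h3]] := appr l l'.
by exists ((c (n + k.+1)).2 (k, mkseq g n)),
  ((c (n + k.+1)).1 (mkseq a1 (n + k.+1)));
  split=> //=; rewrite h3.
Qed.

End limit.

Lemma hom_exists : ~ (exists2 W, rect_cover A W & fB @` SB `<=` W) ->
  exists (u : cantor_space -> X) (v : cantor_space -> Y),
    [/\ continuous u, continuous v, forall a, (fB @` SB) (u a, v a) &
        forall k g, A (u (prepend (rcons (sn k) false) g),
                       v (prepend (rcons (sn k) true) g))].
Proof.
move=> nsep.
have large0 : large (config_points SB).
  move=> W WA; have [p [Sp nWp]] : exists p, SB p /\ ~ W (fB p).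
    apply: contrapT => /forallNP H; apply: nsep; exists W => // _ [p Sp <-].
    by apply: contrapT => nW; apply: (H p).
  have [q Sq] : SA !=set0.
    apply/set0P/eqP => SA0; apply: nsep; exists setT => //.
    rewrite -setXTT; apply: rect_cover_rect; [exact: bset_open pX openT| |].
      exact: bset_open pY openT.
    by rewrite /A SA0 image_set0 setI0.
  by exists ((fun=> p, fun=> q) : config); [split|move=> s].
have /choice[next nextP] : forall nK : nat * set config, exists kappa,
    relclosed nK.2 -> large nK.2 -> large (extension nK.1 nK.2 kappa).
  move=> [n K] /=; have [[Kcl Kg]|no] := pselect (relclosed K /\ large K).
    by have [kappa kP] := extension_large n Kcl Kg; exists kappa.
  by exists ([::], [::]) => Kcl Kg; case: no.
pose K := fix K n := if n is m.+1 then extension m (K m) (next (m, K m))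
  else config_points SB.
have KP n : relclosed (K n) /\ large (K n).
  elim: n => [|n [IHc IHg]]; first by split=> //; split=> [//|c].
  by split; [exact: extension_relclosed|exact: (nextP (n, K n))].
apply: (@limit_hom K (fun n => next (n, K n))) => // n.
by have [c Kc _] := (KP n).2 _ (rect_cover0 A pX pY); exists c.
Qed.

End chain.

(** * Baire category *)

Definition cyl (s : seq bool) : set cantor_space :=
  [set a | mkseq a (size s) = s].

Lemma cyl_cat s r a : cyl (s ++ r) a -> cyl s a.
Proof.
rewrite /cyl /= size_cat mkseqD => /eqP; rewrite eqseq_cat ?size_mkseq//.
by move=> /andP[/eqP].
Qed.

Lemma cyl_nth s (a : cantor_space) i : cyl s a -> i < size s -> a i = nth false s i.
Proof. by move=> sa iS; rewrite -sa nth_mkseq. Qed.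

Lemma nth_cyl s (a : cantor_space) :
  (forall i, i < size s -> a i = nth false s i) -> cyl s a.
Proof.
move=> H; apply: (@eq_from_nth _ false); rewrite size_mkseq// => i iS.
by rewrite nth_mkseq// H.
Qed.

Lemma cyl_prepend s g : cyl s (prepend s g).
Proof. by apply: nth_cyl => i iS; rewrite /prepend iS. Qed.

Lemma cyl_prependE s (a : cantor_space) :
  cyl s a -> a = prepend s (fun i => a (size s + i)).
Proof.
move=> sa; apply/funext => i; rewrite /prepend.
by case: ltnP => iS; [exact: cyl_nth|rewrite subnKC].
Qed.

Lemma cyl_dichotomy s t :
  exists r, (exists r', s ++ r = t ++ r') \/ cyl (s ++ r) `&` cyl t = set0.
Proof.
exists (nseq (size t) false).
have [E|E] := eqVneq (take (size t) (s ++ nseq (size t) false)) t.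
  left; exists (drop (size t) (s ++ nseq (size t) false)).
  by rewrite -[LHS](cat_take_drop (size t)) E.
right; apply/seteqP; split=> // a [sa ta]; case/eqP: E.
rewrite -[in RHS]ta -sa; apply: (@eq_from_nth _ false).
  by rewrite size_takel size_mkseq// size_cat size_nseq leq_addl.
move=> i; rewrite size_take_min => iS; rewrite nth_take ?nth_mkseq//.
- by move: iS; rewrite size_mkseq leq_min => /andP[].
- by move: iS; rewrite size_mkseq leq_min => /andP[].
- by move: iS; rewrite size_mkseq leq_min => /andP[].
Qed.

Definition nowhere_dense (F : set cantor_space) : Prop :=
  forall s, exists r, cyl (s ++ r) `&` F = set0.

Definition meager (M : set cantor_space) : Prop :=
  exists2 F : nat -> set cantor_space,
    forall n, nowhere_dense (F n) & M `<=` \bigcup_n F n.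

Lemma nowhere_dense0 : nowhere_dense set0.
Proof. by move=> s; exists [::]; rewrite setI0. Qed.

Lemma meager_sub M N : M `<=` N -> meager N -> meager M.
Proof. by move=> MN [F Fn NF]; exists F => // a /MN /NF. Qed.

Lemma nowhere_dense_meager F : nowhere_dense F -> meager F.
Proof. by move=> FP; exists (fun=> F) => // a Fa; exists 0. Qed.

Lemma meager0 : meager set0.
Proof. exact/nowhere_dense_meager/nowhere_dense0. Qed.

Lemma meager_bigcup (I : countType) (M : I -> set cantor_space) :
  (forall i, meager (M i)) -> meager (\bigcup_i M i).
Proof.
move=> MP.
have /choice[F FP] : forall i, exists F : nat -> set cantor_space,
    (forall n, nowhere_dense (F n)) /\ M i `<=` \bigcup_n F n.
  by move=> i; have [F ? ?] := MP i; exists F.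
exists (fun m => if unpickle m is Some (i, n) then F i n else set0).
  move=> m; case: unpickle => [[i n]|]; last exact: nowhere_dense0.
  exact: (FP i).1.
move=> a [i _ /(FP i).2[n _ Fa]].
by exists (pickle (i, n)) => //; rewrite pickleK.
Qed.

Lemma meagerU M N : meager M -> meager N -> meager (M `|` N).
Proof.
move=> mM mN; apply: (@meager_sub _ (\bigcup_(b : bool) if b then M else N)).
  by move=> a [|] ?; [exists true|exists false].
by apply: meager_bigcup => -[].
Qed.

Lemma baire M s : meager M -> exists2 a, cyl s a & ~ M a.
Proof.
move=> [F FP MF].
have /choice[r rP] : forall nt : nat * seq bool,
    exists r, cyl (nt.2 ++ r) `&` F nt.1 = set0.
  by move=> [n t]; exact: FP.
pose t := fix t n := if n is m.+1 then t m ++ r (m, t m) ++ [:: false] else s.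
have st n : n <= size (t n).
  elim: n => [//|n IH] /=; rewrite !size_cat /=.
  by rewrite addnA addn1 ltnS (leq_trans IH)// leq_addr.
have tD m n : exists w, t (m + n) = t m ++ w.
  elim: n => [|n [w IH]]; first by exists [::]; rewrite addn0 cats0.
  by rewrite addnS /= IH -catA; eexists.
pose a : cantor_space := fun i => nth false (t i.+1) i.
have ta n : cyl (t n) a.
  apply: nth_cyl => i iS; rewrite /a.
  have [w Ew] := tD n i.+1; have [w' Ew'] := tD i.+1 n.
  have := congr1 (fun x => nth false x i) Ew.
  rewrite addnC Ew' !nth_cat iS.
  by have := st i.+1; rewrite [i.+1 <= _]lock -lock => ->.
exists a; first exact: ta 0.
move=> /MF[n _ Fa]; have : (cyl (t n ++ r (n, t n)) `&` F n) a.
  by split=> //; have := ta n.+1; rewrite /= catA; exact: cyl_cat.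
by rewrite (rP (n, t n)).
Qed.

Lemma meager_local E :
  (forall s, exists r, meager (cyl (s ++ r) `&` E)) -> meager E.
Proof.
move=> /choice[r rP].
apply: (@meager_sub _ (~` (\bigcup_s cyl (s ++ r s)) `|`
                       \bigcup_s (cyl (s ++ r s) `&` E))).
  move=> a Ea; have [[s _ sa]|H] := pselect ((\bigcup_s cyl (s ++ r s)) a).
    by right; exists s.
  by left.
apply: meagerU; last exact: meager_bigcup.
apply: nowhere_dense_meager => s; exists (r s).
by apply/seteqP; split=> // a [sa]; apply; exists s.
Qed.

(* A combinatorial form of the Baire property: [E] is decided up to a meager
   set below densely many words. *)
Definition baire_property (E : set cantor_space) : Prop :=
  forall s, exists r, meager (cyl (s ++ r) `&` E) \/ meager (cyl (s ++ r) `&` ~` E).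

Lemma baire_property_setC E : baire_property E -> baire_property (~` E).
Proof.
move=> bE s; have [r [rE|rE]] := bE s; exists r; [right|left] => //.
by rewrite setCK.
Qed.

Lemma baire_property_open U : open U -> baire_property U.
Proof.
move=> oU s; have [[a [sa Ua]]|no] := pselect (exists a, cyl s a /\ U a); last first.
  exists [::]; left; rewrite cats0; apply: meager_sub meager0 => a [sa Ua].
  by apply: no; exists a.
have /nbhs_cantor[n nU] := open_nbhs_nbhs (conj oU Ua).
exists (mkseq (fun i => a (size s + i)) n); right.
rewrite -{1}sa -mkseqD; apply: meager_sub meager0 => b [ba nUb]; apply: nUb.
apply: nU; apply/in_iotaP => i iN.
have iS : i < size s + n by rewrite (leq_trans iN)// leq_addl.
by rewrite (cyl_nth ba) ?size_mkseq// nth_mkseq.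
Qed.

Lemma baire_property_bigcup (E : nat -> set cantor_space) :
  (forall n, baire_property (E n)) -> baire_property (\bigcup_n E n).
Proof.
move=> bE s.
have [[n [r rE]]|no] := pselect (exists n r, meager (cyl (s ++ r) `&` ~` E n)).
  exists r; right; apply: meager_sub rE => a [sa H]; split=> // Ea.
  by apply: H; exists n.
exists [::]; left; rewrite cats0 setI_bigcupr; apply: meager_bigcup => n.
apply: meager_local => t; have [r [[r' E']|E']] := cyl_dichotomy t s; last first.
  exists r; apply: meager_sub meager0 => a [ta [sa _]].
  by have : (cyl (t ++ r) `&` cyl s) a by []; rewrite E'.
have [w [wE|wE]] := bE n (s ++ r'); last first.
  by case: no; exists n, (r' ++ w); rewrite catA.
exists (r ++ w); rewrite catA E'; apply: meager_sub wE => a [? []] //.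
Qed.

Lemma cover_comeager (E : nat -> set cantor_space) :
  (forall n, baire_property (E n)) -> \bigcup_n E n = setT ->
  exists n s, meager (cyl s `&` ~` E n).
Proof.
move=> bE ET; apply: contrapT => no.
have mE : meager (\bigcup_n E n).
  apply: meager_bigcup => n; apply: meager_local => s.
  have [r [rE|rE]] := bE n s; first by exists r.
  by case: no; exists n, (s ++ r).
by have [a _] := baire [::] mE; rewrite ET; apply.
Qed.

(* Both graphs used below, G_0 and the one without injective homomorphisms,
   consist of pairs [(bit_reindex m0 iota z, z)]. *)
Definition bit_reindex (m0 : nat) (iota : nat -> nat) (z : cantor_space) :
    cantor_space :=
  fun m => if m == m0 then false else z (iota m).

Definition inj_off (m0 : nat) (iota : nat -> nat) : Prop :=
  forall m m', m != m0 -> m' != m0 -> iota m = iota m' -> m = m'.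

Lemma preimage_bound m0 iota n : inj_off m0 iota ->
  exists L, forall m, m != m0 -> iota m < n -> m < L.
Proof.
move=> inj; elim: n => [|n [L LP]]; first by exists 0.
have [[k [km0 kn]]|no] := pselect (exists k, k != m0 /\ iota k = n).
  exists (maxn L k.+1) => m mm0; rewrite ltnS leq_eqVlt => /orP[/eqP mn|mn].
    by rewrite (inj m k)// ?kn// leq_max leqnn orbT.
  by rewrite leq_max LP.
exists L => m mm0; rewrite ltnS leq_eqVlt => /orP[/eqP mn|]; last exact: LP.
by case: no; exists m.
Qed.

Lemma bit_reindex_nowhere_dense m0 iota F : inj_off m0 iota ->
  nowhere_dense F -> nowhere_dense (bit_reindex m0 iota @^-1` F).
Proof.
move=> inj FP s; have [L LP] := preimage_bound (size s) inj.
pose q := mkseq (fun m => if m == m0 then false else nth false s (iota m))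
  (maxn L m0.+1).
have [r rF] := FP q.
have /choice[z zP] : forall i, exists b : bool,
    (i < size s -> b = nth false s i) /\
    (size s <= i -> forall m, m != m0 -> m < size (q ++ r) -> iota m = i ->
      b = nth false (q ++ r) m).
  move=> i; have [iS|iS] := ltnP i (size s); first by exists (nth false s i).
  have [[m [mm0 mi]]|no] := pselect (exists m, m != m0 /\ iota m = i).
    exists (nth false (q ++ r) m); split=> // _ m' m'm0 _ m'i.
    by congr nth; apply: inj; rewrite ?mi.
  by exists false; split=> // _ m mm0 _ mi; case: no; exists m.
pose N := (\max_(m < size (q ++ r)) iota m).+1.
exists (mkseq (fun i => z (size s + i)) N).
apply/seteqP; split=> // a [az Fa].
have {}az i : i < size s + N -> a i = z i.
  move=> iS; rewrite (cyl_nth az) ?size_cat ?size_mkseq// nth_cat.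
  case: ltnP => h; first by rewrite (zP i).1.
  by rewrite nth_mkseq ?subnKC// ltn_subLR.
suff : (cyl (q ++ r) `&` F) (bit_reindex m0 iota a) by rewrite rF.
split=> //; apply: nth_cyl => m mS; rewrite /bit_reindex.
have [->|mm0] := eqVneq m m0.
  have m0L : m0 < maxn L m0.+1 by rewrite leq_max ltnSn orbT.
  by rewrite nth_cat size_mkseq m0L nth_mkseq// eqxx.
have iN : iota m < N by rewrite ltnS (leq_bigmax (Ordinal mS)).
rewrite az ?(leq_trans iN) ?leq_addl//.
have [h|h] := ltnP (iota m) (size s); last exact: (zP _).2.
have mL : m < maxn L m0.+1 by rewrite leq_max LP.
by rewrite (zP _).1// nth_cat size_mkseq mL nth_mkseq// (negbTE mm0).
Qed.

Lemma bit_reindex_meager m0 iota M : inj_off m0 iota ->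
  meager M -> meager (bit_reindex m0 iota @^-1` M).
Proof.
move=> inj [F FP MF]; exists (fun n => bit_reindex m0 iota @^-1` F n).
  by move=> n; exact: bit_reindex_nowhere_dense.
by move=> a /MF[n _ Fa]; exists n.
Qed.

Lemma ana_decided (I : countType) (T : topologicalType) (e : T -> I -> nat)
    (l : seq I) (S : set T) : closed_code e setT -> cont_code e setT id ->
  (forall a b, {in l, e a =1 e b} -> S a -> S b) -> ana S.
Proof.
move=> ce conte Sl; exists T, (to_nat e), S, id; split; last exact: image_id.
  apply: closed_code_to_nat; apply: (closed_code_sub ce) => // a _ /(_ l)[b Sb ba].
  exact: Sl ba Sb.
by apply: cont_code_to_nat; exact: cont_code_sub conte.
Qed.

Lemma presents_cantor : presents (fun (a : cantor_space) i => nat_of_bool (a i)).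
Proof.
split=> [z zP|a V _ /nbhs_cantor[n nV]]; last first.
  exists (iota 0 n) => b _ ba; apply: nV => i /ba.
  by case: (b i); case: (a i).
exists (fun i => z i == 1) => // i.
have [a _ /(_ i (mem_head _ _)) <-] := zP [:: i].
by case: (a i).
Qed.

Lemma presents_finer (R : realType) (X : topologicalType) (cX : Topological X) :
  polish R (Topological.Pack cX) -> @open X `<=` @open (Topological.Pack cX) ->
  exists2 g : X -> nat -> nat, presents g &
    @cont_code _ _ g setT (Topological.Pack cX) id.
Proof.
move=> /polish_presented[g [cg contg]] sub; exists g => //; split=> //.
move=> x V _; rewrite nbhsE => -[U [oU Ux] UV].
have [|l lU] := contg x U Logic.I.
  exact: open_nbhs_nbhs (conj (sub _ oU) Ux).
by exists l => y _ yx; apply: UV; exact: lU.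
Qed.

Lemma not_potentially_closed (R : realType) (X Y : topologicalType)
    (A D : set (X * Y)) (u : cantor_space -> X) (v : cantor_space -> Y) :
  hausdorff_space X -> hausdorff_space Y -> continuous u -> continuous v ->
  (forall s, exists m0 iota r, inj_off m0 iota /\
     forall z, cyl (s ++ r) z ->
       cyl s (bit_reindex m0 iota z) /\ A (u (bit_reindex m0 iota z), v z)) ->
  potentially_closed R D -> A `<=` D -> ~ (forall a, ~ D (u a, v a)).
Proof.
move=> hX hY cu cv HA [cX [cY [pX' pY' sX sY cD]]] AD Dd.
have [gX gXP contX] := presents_finer pX' sX.
have [gY gYP contY] := presents_finer pY' sY.
have [cC contC] := presents_cantor.
pose e1 := sum_code (fun (a : cantor_space) i => nat_of_bool (a i)) (gX \o u).
pose e := sum_code e1 (gY \o v).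
have conte1 (T : topologicalType) (f : cantor_space -> T) :
    continuous f -> cont_code e1 setT f.
  move=> cf; apply: (@finer_cont _ _ _
    (fun (a : cantor_space) i => nat_of_bool (a i))).
    by move=> i; exists (inl i).
  exact: cont_code_comp contC cf.
have ce1 : closed_code e1 setT.
  by apply: closed_code_pullback => //; exact: cont_code_comp contC cu.
have ce : closed_code e setT.
  by apply: closed_code_pullback => //; exact: conte1.
have conte : cont_code e setT (id : cantor_space -> cantor_space).
  apply: (@finer_cont _ _ _ e1); first by move=> i; exists (inl i).
  by apply: conte1 => a.
pose E (k : nat * (seq nat * seq nat)) := [set a : cantor_space |
  mkseq (gX (u a)) k.1 = k.2.1 /\ mkseq (gY (v a)) k.1 = k.2.2].
have E_dec k : exists l : seq (nat + nat + nat),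
    forall a b, {in l, e a =1 e b} -> E k a <-> E k b.
  exists ([seq inl (inr i) | i <- iota 0 k.1] ++
    [seq inr i | i <- iota 0 k.1]) => a b ab.
  suff [E1 E2] : mkseq (gX (u a)) k.1 = mkseq (gX (u b)) k.1 /\
    mkseq (gY (v a)) k.1 = mkseq (gY (v b)) k.1 by rewrite /E /= E1 E2.
  split; apply/mkseq_eq => i il.
    by apply: (ab (inl (inr i))); rewrite mem_cat map_f.
  by apply: (ab (inr i)); rewrite mem_cat [X in _ || X]map_f// orbT.
have bpE k : baire_property (E k).
  have [l lP] := E_dec k.
  have [|||C [bC EC CE]] := @lusin_separation _ baire_property
    cantor_space_hausdorff baire_property_open baire_property_setC
    baire_property_bigcup (E k) (~` E k).
  - by apply: (ana_decided ce conte) => a b /lP[].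
  - by apply: (ana_decided ce conte) => a b /lP[_ ba] nEa /ba.
  - by rewrite setICr.
  suff <- : C = E k by [].
  apply/seteqP; split=> // a Ca; apply: contrapT => nEa.
  by have : (C `&` ~` E k) a by []; rewrite CE.
pose ok k := forall a b, E k a -> E k b -> ~ D (u a, v b).
pose E' n := if unpickle n is Some k then [set a | ok k /\ E k a] else set0.
have bpE' n : baire_property (E' n).
  rewrite /E'; case: unpickle => [k|]; last exact: baire_property_open open0.
  have [okk|nok] := pselect (ok k).
    suff -> : [set a | ok k /\ E k a] = E k by [].
    by apply/seteqP; split=> a // [].
  suff -> : [set a | ok k /\ E k a] = set0 by exact: baire_property_open open0.
  by apply/seteqP; split=> a // [].
have E'T : \bigcup_n E' n = setT.
  apply/seteqP; split=> // a _.
  have : nbhs ((u a : Topological.Pack cX), (v a : Topological.Pack cY)) (~` D).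
    by apply: open_nbhs_nbhs; split; [exact: closed_openC|exact: Dd].
  move=> [[U V] /= [uU vV] UV].
  have [l lU] := contX _ _ Logic.I uU; have [l' lV] := contY _ _ Logic.I vV.
  have [n ln] := seq_nat_bound (l ++ l').
  pose k := (n, (mkseq (gX (u a)) n, mkseq (gY (v a)) n)).
  exists (pickle k) => //; rewrite /E' pickleK; split=> //.
  move=> b c [/mkseq_eq bE _] [_ /mkseq_eq cE]; apply: (UV (u b, v c)); split=> /=.
    by apply: lU => // i il; apply: bE; rewrite ln// mem_cat il.
  by apply: lV => // i il; apply: cE; rewrite ln// mem_cat il orbT.
have [n [s sE]] := cover_comeager bpE' E'T.
have [m0 [iota [r [inj HAs]]]] := HA s.
have [z zs zM] := baire (s ++ r) (meagerU sE (bit_reindex_meager inj sE)).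
have [hs hA] := HAs z zs.
have inE' a : cyl s a -> ~ (cyl s `&` ~` E' n) a -> E' n a.
  by move=> sa H; apply: contrapT => nE; apply: H.
have E'z : E' n z.
  by apply: inE'; [exact: cyl_cat zs|move=> H; apply: zM; left].
have E'h : E' n (bit_reindex m0 iota z).
  by apply: inE' => // H; apply: zM; right.
move: E'z E'h; rewrite /E'; case: unpickle => [k|//] [okk Ez] [_ Eh].
exact: (okk _ _ Eh Ez) (AD _ hA).
Qed.

(** * The graph A_1 *)

Lemma flatten_words_prefix m n : m <= n -> exists w,
  flatten (map words (iota 0 n)) = flatten (map words (iota 0 m)) ++ w.
Proof.
move=> /subnKC <-; rewrite iotaD map_cat flatten_cat; by eexists.
Qed.

Lemma size_flatten_words n : n <= size (flatten (map words (iota 0 n))).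
Proof.
elim: n => [//|n IH]; rewrite -addn1 iotaD map_cat flatten_cat size_cat.
rewrite leq_add//= cats0 -(size_nseq n true).
by case: (words _) (words_mem (nseq n true)).
Qed.

Lemma psi_surj s : exists n, psi n = s.
Proof.
pose L n := flatten (map words (iota 0 n)).
have sL : s \in L (size s).+1.
  apply/flattenP; exists (words (size s)); last exact: words_mem.
  by rewrite map_f// mem_iota /= add0n.
set n := index s (L (size s).+1); exists n; rewrite /psi -/(L n.+1).
have nL : n < size (L (size s).+1) by rewrite index_mem.
have nL' : n < size (L n.+1) by exact: size_flatten_words.
have [w E] := flatten_words_prefix (leq_maxl (size s).+1 n.+1).
have [w' E'] := flatten_words_prefix (leq_maxr (size s).+1 n.+1).
have <- : nth [::] (L (maxn (size s).+1 n.+1)) n = nth [::] (L n.+1) n.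
  by rewrite [L (maxn _ _)]E' nth_cat nL'.
by rewrite [L (maxn _ _)]E nth_cat nL nth_index.
Qed.

Lemma sn_dense s : exists n r, sn n = s ++ r.
Proof. by have [n <-] := psi_surj s; exists n; eexists. Qed.

Lemma prepend_out s (g : cantor_space) i : prepend s g (size s + i) = g i.
Proof. by rewrite /prepend ltnNge leq_addr addKn. Qed.

Lemma A1P (a b : cantor_space) : A1 (a, b) <-> exists n,
  [/\ cyl (rcons (sn n) false) a, cyl (rcons (sn n) true) b &
      forall i, n < i -> a i = b i].
Proof.
split=> [[n [g [-> ->]]]|[n [an bn ab]]].
  exists n; split; [exact: cyl_prepend|exact: cyl_prepend|] => i ni.
  by rewrite /prepend !size_rcons !size_sn ltnNge ni.
exists n, (fun i => a (n.+1 + i)).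
rewrite {1}(cyl_prependE an) (cyl_prependE bn) !size_rcons !size_sn.
by congr (_, prepend _ _); apply/funext => i; rewrite ab// ltnS leq_addr.
Qed.

Lemma cyl_rcons_sn n b a : cyl (rcons (sn n) b) a -> cyl (sn n) a /\ a n = b.
Proof.
rewrite -cats1 => H; split; first exact: cyl_cat H.
have nS : n < size (sn n ++ [:: b]) by rewrite cats1 size_rcons size_sn.
by rewrite (cyl_nth H nS) nth_cat size_sn ltnn subnn.
Qed.

Lemma A1_diff (a b : cantor_space) : A1 (a, b) -> exists n,
  [/\ a n = false, b n = true & forall i, i != n -> a i = b i].
Proof.
move=> /A1P[n [/cyl_rcons_sn[sa an] /cyl_rcons_sn[sb bn] ab]]; exists n.
split=> // i; rewrite neq_ltn => /orP[iN|]; last exact: ab.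
by rewrite (cyl_nth sa) ?(cyl_nth sb) ?size_sn.
Qed.

Lemma A1_irr (a : cantor_space) : ~ A1 (a, a).
Proof. by move=> /A1_diff[n [-> ]]. Qed.

Lemma A1_asym (a b : cantor_space) : A1 (a, b) -> ~ A1 (b, a).
Proof.
move=> /A1_diff[n [an bn ab]] /A1_diff[m [bm am _]].
have [nm|nm] := eqVneq m n; first by move: am; rewrite nm an.
by have := ab m nm; rewrite am bm.
Qed.

Lemma closure_A1_diag (a : cantor_space) : (closure A1 `\` A1) (a, a).
Proof.
split; last exact: A1_irr.
move=> W [[U V] /= [/nbhs_cantor[n nU] /nbhs_cantor[m mV]] UV].
have [k [r kE]] := sn_dense (mkseq a (maxn n m)).
pose x b := prepend (rcons (sn k) b) a.
have xa b : {in iota 0 (maxn n m), x b =1 a}.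
  apply/in_iotaP => i iN; have : cyl (rcons (sn k) b) (x b) by exact: cyl_prepend.
  move=> /cyl_rcons_sn[]; rewrite kE => /cyl_cat H _.
  by rewrite (cyl_nth H) ?size_mkseq// nth_mkseq.
exists (x false, x true); split; first by exists k, a.
apply: UV; split=> /=.
  apply: nU => i; rewrite mem_iota add0n /= => iN; apply: xa.
  by rewrite mem_iota add0n /= leq_max iN.
apply: mV => i; rewrite mem_iota add0n /= => iN; apply: xa.
by rewrite mem_iota add0n /= leq_max iN orbT.
Qed.

Lemma closure_A1_sub (a b : cantor_space) : (closure A1 `\` A1) (a, b) -> a = b.
Proof.
move=> [cl nA]; apply/funext => i; apply: contrapT => ni; apply: nA.
have approx N : exists x y,
    [/\ A1 (x, y), {in iota 0 N, x =1 a} & {in iota 0 N, y =1 b}].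
  have [|[x y] [xyA [/= xa yb]]] := cl
    ([set x : cantor_space | {in iota 0 N, x =1 a}] `*`
     [set y : cantor_space | {in iota 0 N, y =1 b}]).
    exists ([set x : cantor_space | {in iota 0 N, x =1 a}],
      [set y : cantor_space | {in iota 0 N, y =1 b}]) => //=.
    by split; apply/nbhs_cantor; exists N.
  by exists x, y.
have [x [y [/A1P[n [xn yn xy]] /in_iotaP xa /in_iotaP yb]]] := approx i.+1.
have [sx nx] := cyl_rcons_sn xn; have [sy ny] := cyl_rcons_sn yn.
have first_diff (x' y' : cantor_space) m N : i < N ->
    cyl (rcons (sn m) false) x' -> cyl (rcons (sn m) true) y' ->
    (forall j, m < j -> x' j = y' j) ->
    {in iota 0 N, x' =1 a} -> {in iota 0 N, y' =1 b} -> m = i.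
  move=> iN /cyl_rcons_sn[sx' _] /cyl_rcons_sn[sy' _] xy'.
  move=> /in_iotaP xa' /in_iotaP yb'.
  apply/eqP/negPn/negP; rewrite neq_ltn => /orP[mi|im]; apply: ni.
    by rewrite -xa'// -yb'// xy'.
  by rewrite -xa'// -yb'// (cyl_nth sx') ?(cyl_nth sy') ?size_sn.
apply/A1P; exists i.
have tail N : i < N -> exists x y, [/\ cyl (rcons (sn i) false) x,
    cyl (rcons (sn i) true) y, forall j, i < j -> x j = y j,
    {in iota 0 N, x =1 a} & {in iota 0 N, y =1 b}].
  move=> iN; have [x' [y' [/A1P[m [h1 h2 h3]] h4 h5]]] := approx N.
  have mi := first_diff _ _ _ _ iN h1 h2 h3 h4 h5.
  move: h1 h2 h3; rewrite mi => h1 h2 h3.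
  by exists x', y'.
split.
- have [x' [y' [h1 _ _ /in_iotaP h4 _]]] := tail i.+1 (ltnSn i).
  apply: nth_cyl => j jS; rewrite -(cyl_nth h1)// h4//.
  by move: jS; rewrite size_rcons size_sn.
- have [x' [y' [_ h1 _ _ /in_iotaP h4]]] := tail i.+1 (ltnSn i).
  apply: nth_cyl => j jS; rewrite -(cyl_nth h1)// h4//.
  by move: jS; rewrite size_rcons size_sn.
move=> j ij; have [|x' [y' [_ _ h /in_iotaP h4 /in_iotaP h5]]] := tail j.+1.
  exact: ltnW.
by rewrite -h4// -h5// h.
Qed.

Lemma A1_reindex s : exists m0 iota r, inj_off m0 iota /\
  forall z, cyl (s ++ r) z ->
    cyl s (bit_reindex m0 iota z) /\ A1 (bit_reindex m0 iota z, z).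
Proof.
have [n [r nE]] := sn_dense s; exists n, id, (rcons r true); split=> // z.
rewrite -rcons_cat -nE => zn; have [sz zt] := cyl_rcons_sn zn.
have hz : cyl (rcons (sn n) false) (bit_reindex n id z).
  apply: nth_cyl => i; rewrite size_rcons size_sn nth_rcons size_sn /bit_reindex.
  have [->|ni] := eqVneq i n; first by rewrite ltnn.
  rewrite ltnS leq_eqVlt (negbTE ni) /= => iN.
  by rewrite iN (cyl_nth sz) ?size_sn.
split; first by have [] := cyl_rcons_sn hz; rewrite nE => /cyl_cat.
apply/A1P; exists n; split=> // i ni; rewrite /bit_reindex.
by case: eqP => // E; move: ni; rewrite E ltnn.
Qed.

(** * Counterexamples *)

Lemma polish_cantor (R : realType) : polish R cantor_space.
Proof.
apply: (@polish_coded R cantor_space (fun a i => nat_of_bool (a i))).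
- by move=> a b ab; apply/funext => i; move: (ab i); case: (a i); case: (b i).
- exact: presents_cantor.1.
move=> a V; rewrite nbhs_cantor; split=> -[n nV]; exists n => b ba; apply: nV => i.
  by move=> /ba; case: (a i); case: (b i).
by move=> /ba ->.
Qed.

Lemma cantor_continuous (f : cantor_space -> cantor_space) :
  (forall i, exists N, forall a b : cantor_space,
     {in iota 0 N, a =1 b} -> f a i = f b i) -> continuous f.
Proof.
move=> /choice[N NP] a V /nbhs_cantor[n nV]; apply/nbhs_cantor.
exists (\max_(i < n) N i) => b /in_iotaP ba; apply: nV; apply/in_iotaP => i iN.
apply: NP; apply/in_iotaP => j jN; apply: ba.
by rewrite (leq_trans jN)// (leq_bigmax (Ordinal iN)).
Qed.

Lemma prepend_continuous s : continuous (prepend s).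
Proof.
apply: cantor_continuous => i; exists (i - size s).+1 => a b /in_iotaP ab.
by rewrite /prepend; case: ltnP => // _; exact: ab.
Qed.

Lemma bit_reindex_continuous m0 iota : continuous (bit_reindex m0 iota).
Proof.
apply: cantor_continuous => i; exists (iota i).+1 => a b /in_iotaP ab.
by rewrite /bit_reindex; case: eqP => // _; exact: ab.
Qed.

Lemma analytic_bigcup_range (R : realType) (Z : topologicalType)
    (h : nat -> cantor_space -> Z) :
  (forall n, continuous (h n)) -> analytic R (\bigcup_n range (h n)).
Proof.
move=> ch.
pose g (p : nat * cantor_space) (i : nat) : nat :=
  if i is j.+1 then nat_of_bool (p.2 j) else p.1.
have g_inj p q : g p =1 g q -> p = q.
  case: p q => [n a] [m b] pq; congr pair; first exact: (pq 0).
  by apply/funext => i; move: (pq i.+1) => /=; case: (a i); case: (b i).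
have cg : closed_code g setT.
  move=> z zP; exists (z 0, fun i => z i.+1 == 1) => // -[//|i] /=.
  have [p _ /(_ i.+1 (mem_head _ _)) <-] := zP [:: i.+1].
  by rewrite /=; case: (p.2 i).
exists (coded R g_inj); split.
  by apply: (@polish_coded R (coded R g_inj) g) => // x V; exact: nbhs_coded.
exists (fun p => h p.1 p.2).
  move=> [n a] V /= /ch /nbhs_cantor[k kV]; apply/nbhs_coded.
  exists k.+1 => -[m b] /in_iotaP ba; have /= -> := ba 0 isT.
  apply: kV; apply/in_iotaP => i ik; move: (ba i.+1 ik) => /=.
  by case: (a i); case: (b i).
apply/seteqP; split=> [x [[n a] _ <-]|x [n _ [a _ <-]]].
  by exists n => //; exists a.
by exists (n, a).
Qed.

Lemma A1_analytic (R : realType) : analytic R A1.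
Proof.
have -> : A1 = \bigcup_n range (fun g =>
    (prepend (rcons (sn n) false) g, prepend (rcons (sn n) true) g)).
  apply/seteqP; split=> [p [n [g ->]]|p [n _ [g _ <-]]].
    by exists n => //; exists g.
  by exists n, g.
apply: analytic_bigcup_range => n a.
exact: cvg_pair (@prepend_continuous _ a) (@prepend_continuous _ a).
Qed.

Definition cantor_diag : set (cantor_space * cantor_space) :=
  [set p | p.1 = p.2].

Lemma cantor_diag_analytic (R : realType) : analytic R cantor_diag.
Proof.
exists cantor_space; split; first exact: polish_cantor.
exists (fun a => (a, a)); first by move=> a; exact: cvg_pair cvg_id cvg_id.
apply/seteqP; split=> [_ [a _ <-] //|[a b]].
by rewrite /cantor_diag /= => <-; exists a.
Qed.

(* The bits of a point of the Cantor space are split into infinitely many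
   columns; bit [m] lies in column [column m]. *)
Definition column (m : nat) : nat :=
  (odflt (0, 0) (unpickle m : option (nat * nat))).1.

Lemma column_pickle (k i : nat) : column (pickle (k, i)) = k.
Proof. by rewrite /column pickleK. Qed.

Definition spread_index (k m : nat) : nat :=
  if column m < k then m else pickle (k, m.+1).

(* Keeps the columns before [k], clears the first bit of column [k], and
   overwrites everything else with the remaining bits of column [k]. *)
Definition spread (k : nat) : cantor_space -> cantor_space :=
  bit_reindex (pickle (k, 0)) (spread_index k).

Definition spread_graph : set (cantor_space * cantor_space) :=
  [set p | exists k, p.2 (pickle (k, 0)) = true /\ p.1 = spread k p.2].

Lemma spread_first k z : spread k z (pickle (k, 0)) = false.
Proof. by rewrite /spread /bit_reindex eqxx. Qed.

Lemma spread_low k z m : column m < k -> spread k z m = z m.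
Proof.
move=> mk; rewrite /spread /bit_reindex /spread_index mk.
by case: eqP => // E; move: mk; rewrite E column_pickle ltnn.
Qed.

Lemma spread_eq k z z' : (forall m, column m <= k -> z m = z' m) ->
  spread k z = spread k z'.
Proof.
move=> zz'; apply/funext => m; rewrite /spread /bit_reindex /spread_index.
case: eqP => // _; apply: zz'; case: ifP => [/ltnW//|_].
by rewrite column_pickle.
Qed.

Lemma spread_index_inj k : inj_off (pickle (k, 0)) (spread_index k).
Proof.
move=> m m' _ _; rewrite /spread_index.
case: ifP => mk; case: ifP => m'k // E.
- by move: mk; rewrite E column_pickle ltnn.
- by move: m'k; rewrite -E column_pickle ltnn.
by have [] := pcan_inj (@pickleK _) E.
Qed.

Lemma spread_graph_bit_reindex s : exists m0 iota r, inj_off m0 iota /\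
  forall z, cyl (s ++ r) z ->
    cyl s (bit_reindex m0 iota z) /\ spread_graph (bit_reindex m0 iota z, z).
Proof.
pose k := (\max_(m < size s) column m).+1.
have sk m : m < size s -> column m < k.
  by move=> ms; rewrite ltnS (leq_bigmax (Ordinal ms)).
have ks : size s <= pickle (k, 0).
  by rewrite leqNgt; apply/negP => /sk; rewrite column_pickle ltnn.
exists (pickle (k, 0)), (spread_index k).
exists (nseq (pickle (k, 0) - size s).+1 true).
split=> [|z sz]; first exact: spread_index_inj.
split.
  apply: nth_cyl => i iS; rewrite -/(spread k z) spread_low ?sk//.
  by rewrite (cyl_nth (cyl_cat sz)).
exists k; split=> //=; rewrite (cyl_nth sz).
  by rewrite nth_cat (leq_gtF ks) nth_nseq ltnSn.
by rewrite size_cat size_nseq addnS ltnS subnKC.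
Qed.

Lemma spread_graph_analytic (R : realType) : analytic R spread_graph.
Proof.
pose set1 (k : nat) (z : cantor_space) : cantor_space :=
  fun m => if m == pickle (k, 0) then true else z m.
have -> : spread_graph = \bigcup_k range (fun z => (spread k (set1 k z), set1 k z)).
  apply/seteqP; split=> [[x z] [k /= [zk ->]]|p [k _ [z _ <-]]].
    exists k => //; exists z => //.
    suff -> : set1 k z = z by [].
    by apply/funext => m; rewrite /set1; case: eqP => // ->.
  by exists k; rewrite /= /set1 eqxx.
have cset k : continuous (set1 k).
  apply: cantor_continuous => i; exists i.+1 => a b /in_iotaP ab.
  by rewrite /set1; case: eqP => // _; exact: ab.
have cspread k : continuous (fun z => spread k (set1 k z)).
  by move=> z; apply: continuous_comp; [exact: cset|exact: bit_reindex_continuous].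
by apply: analytic_bigcup_range => k z; exact: cvg_pair (cspread k z) (cset k z).
Qed.

Lemma spread_graph_diag : spread_graph `&` cantor_diag = set0.
Proof.
apply/seteqP; split=> // -[x z] [[k /= [zk xE]] xz].
by move: zk; rewrite -[z]xz /= xE spread_first.
Qed.

Definition first_bits_eq (k : nat) (x y : cantor_space) : Prop :=
  forall j, j <= k -> x (pickle (j, 0)) = y (pickle (j, 0)).

(* The label of an edge is the first column in which the leading bits differ. *)
Lemma spread_label K k x x' y y' :
  x = spread K y -> y (pickle (K, 0)) = true ->
  x' = spread k y' -> y' (pickle (k, 0)) = true ->
  first_bits_eq K x x' -> first_bits_eq K y y' -> k = K.
Proof.
move=> xE yK x'E y'k xx yy; apply/eqP; rewrite eqn_leq; apply/andP; split.
  rewrite leqNgt; apply/negP => Kk.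
  have : x' (pickle (K, 0)) = y' (pickle (K, 0)).
    by rewrite x'E spread_low// column_pickle.
  by rewrite -xx// -yy// yK xE spread_first.
rewrite leqNgt; apply/negP => kK.
have : x (pickle (k, 0)) = y (pickle (k, 0)).
  by rewrite xE spread_low// column_pickle.
by rewrite xx ?(ltnW kK)// yy ?(ltnW kK)// y'k x'E spread_first.
Qed.

Lemma first_bits_near (f : cantor_space -> cantor_space) (g : cantor_space) K :
  continuous f -> exists N, forall g' : cantor_space,
    {in iota 0 N, g' =1 g} -> first_bits_eq K (f g) (f g').
Proof.
move=> cf; pose M := (\max_(j < K.+1) pickle (nat_of_ord j, 0)).+1.
have /cf/nbhs_cantor[N NP] :
    nbhs (f g) [set b : cantor_space | {in iota 0 M, b =1 f g}].
  by apply/nbhs_cantor; exists M.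
exists N => g' /NP /in_iotaP H j jK; apply/esym/H; rewrite ltnS.
by rewrite (leq_bigmax (Ordinal (jK : j < K.+1))).
Qed.

Lemma spread_graph_not_inj (u : cantor_space -> cantor_space) :
  continuous u -> (forall p, A1 p -> spread_graph (u p.1, u p.2)) ->
  ~ injective u.
Proof.
move=> cu uA uinj.
pose P b := prepend (rcons (sn 0) b).
have PA g : spread_graph (u (P false g), u (P true g)).
  by apply: (uA (_, _)); exists 0, g.
pose g0 : cantor_space := fun=> false.
have [K [/= yK xE]] := PA g0.
have cP b : continuous (u \o P b).
  by move=> a; apply: continuous_comp; [exact: prepend_continuous|exact: cu].
have [N0 N0P] := first_bits_near g0 K (cP false).
have [N1 N1P] := first_bits_near g0 K (cP true).
pose N := maxn N0 N1.
have near0 g : {in iota 0 N, g =1 g0} ->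
    first_bits_eq K (u (P true g0)) (u (P true g)) /\
    u (P false g) = spread K (u (P true g)).
  move=> /in_iotaP gg.
  have gg0 : {in iota 0 N0, g =1 g0}.
    by apply/in_iotaP => i iN; rewrite gg// leq_max iN.
  have gg1 : {in iota 0 N1, g =1 g0}.
    by apply/in_iotaP => i iN; rewrite gg// leq_max iN orbT.
  split; first exact: N1P.
  have [k [/= y'k x'E]] := PA g.
  by rewrite x'E (spread_label xE yK x'E y'k (N0P _ gg0) (N1P _ gg1)).
have [m [r mE]] := sn_dense (rcons (sn 0) true ++ mkseq g0 N).
pose a b := prepend (rcons (sn m) b) g0.
pose g b : cantor_space := fun i => a b (1 + i).
have acyl b : cyl (rcons (sn 0) true ++ mkseq g0 N) (a b).
  have /cyl_rcons_sn[] : cyl (rcons (sn m) b) (a b) by exact: cyl_prepend.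
  by rewrite mE => /cyl_cat.
have aP b : a b = P true (g b).
  by rewrite {1}(cyl_prependE (cyl_cat (acyl b))) size_rcons size_sn.
have gg b : {in iota 0 N, g b =1 g0}.
  apply/in_iotaP => i iN.
  have iS : 1 + i < size (rcons (sn 0) true ++ mkseq g0 N).
    by rewrite size_cat size_rcons size_sn size_mkseq ltn_add2l.
  rewrite /g (cyl_nth (acyl b) iS) nth_cat size_rcons size_sn add1n /= subn1.
  by rewrite nth_mkseq.
have [f0 e0] := near0 _ (gg false); have [f1 e1] := near0 _ (gg true).
have [M [/= yM aE]] : spread_graph (u (a false), u (a true)).
  by apply: (uA (_, _)); exists m, g0.
have KM : K < M.
  rewrite ltnNge; apply/negP => MK.
  have := f0 M MK; rewrite f1// -!aP yM aE spread_first.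
  by [].
have : u (P false (g false)) = u (P false (g true)).
  rewrite e0 e1 -!aP aE; apply: spread_eq => j jK.
  by rewrite spread_low// (leq_ltn_trans jK).
move=> /uinj PE; have gE i : g false i = g true i.
  have := congr1 (fun x : cantor_space => x (size (rcons (sn 0) false) + i)) PE.
  by rewrite /P !prepend_out.
have m0 : 0 < m by rewrite -(size_sn m) mE !size_cat size_rcons.
have am b : a b m = b.
  have /cyl_rcons_sn[] // : cyl (rcons (sn m) b) (a b) by exact: cyl_prepend.
by have := gE m.-1; rewrite /g add1n prednK// !am.
Qed.

Theorem theorem9 (R : realType) :
  [/\ dichotomy R (fun (X Y : topologicalType) (A B : set (X * Y)) =>
        exists (u : cantor_space -> X) (v : cantor_space -> Y),
          [/\ continuous u, continuous v,
              A1 `<=` prod_map u v @^-1` A &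
              closure A1 `\` A1 `<=` prod_map u v @^-1` B]),
      ~ dichotomy R (fun (X Y : topologicalType) (A B : set (X * Y)) =>
        exists (u : cantor_space -> X) (v : cantor_space -> Y),
          [/\ continuous u, continuous v,
              A1 `<=` prod_map u v @^-1` A &
              ~` A1 `<=` prod_map u v @^-1` B])
    & ~ dichotomy R (fun (X Y : topologicalType) (A B : set (X * Y)) =>
        exists (u : cantor_space -> X) (v : cantor_space -> Y),
          [/\ continuous u /\ injective u, continuous v /\ injective v,
              A1 `<=` prod_map u v @^-1` A &
              closure A1 `\` A1 `<=` prod_map u v @^-1` B])].
Proof.
have pC := polish_cantor R; have hC := cantor_space_hausdorff.
have cid : continuous (id : cantor_space -> cantor_space) by move=> a.
have excl (G D : set (cantor_space * cantor_space)) :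
    (forall s, exists m0 iota r, inj_off m0 iota /\
       forall z, cyl (s ++ r) z ->
         cyl s (bit_reindex m0 iota z) /\ G (bit_reindex m0 iota z, z)) ->
    potentially_closed R D -> G `<=` D -> D `&` cantor_diag = set0 -> False.
  move=> HG pD GD Dd.
  apply: (not_potentially_closed hC hC cid cid HG pD GD) => a Da.
  by have : (D `&` cantor_diag) (a, a) by []; rewrite Dd.
split.
- move=> X Y pX pY A B aA aB AB.
  have hX := polish_hausdorff pX; have hY := polish_hausdorff pY.
  have ab (u : cantor_space -> X) (v : cantor_space -> Y) D :
      continuous u -> continuous v -> A1 `<=` prod_map u v @^-1` A ->
      closure A1 `\` A1 `<=` prod_map u v @^-1` B ->
      potentially_closed R D -> A `<=` D -> D `&` B = set0 -> False.
    move=> cu cv uA uB pD AD DB.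
    apply: (not_potentially_closed hX hY cu cv (A := A) _ pD AD) => [s|a Da].
      have [m0 [iota [r [inj H]]]] := A1_reindex s.
      exists m0, iota, r; split=> // z /H[sz zA]; split=> //; exact: uA zA.
    have Ba := uB _ (closure_A1_diag a).
    by have : (D `&` B) (u a, v a) by []; rewrite DB.
  have [[W WA BW]|no] := pselect (exists2 W, rect_cover A W & B `<=` W).
    have pD := rect_cover_potentially_closed pX pY WA.
    have AD : A `<=` ~` W.
      have [C [D [_ _ _ WA0]]] := WA.
      by move=> p Ap Wp; have : (W `&` A) p by []; rewrite WA0.
    have DB : ~` W `&` B = set0 by apply/seteqP; split=> // p [nW /BW].
    left; split; first by exists (~` W).
    by move=> [u [v [cu cv uA uB]]]; exact: (ab u v (~` W)).
  have [PA [gA [SA [fA [cA contA AE]]]]] := analytic_ana aA.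
  have [PB [gB [SB [fB [cB contB BE]]]]] := analytic_ana aB.
  have nsep : ~ (exists2 W, rect_cover (fA @` SA) W & fB @` SB `<=` W).
    by rewrite AE BE.
  have [u [v [cu cv uB uA]]] := hom_exists pX pY cA contA cB contB nsep.
  have uA' : A1 `<=` prod_map u v @^-1` A.
    by move=> _ [n [g ->]]; rewrite -AE; exact: uA.
  have uB' : closure A1 `\` A1 `<=` prod_map u v @^-1` B.
    by move=> [a b] /closure_A1_sub <-; rewrite -BE; exact: uB.
  right; split; last by exists u, v.
  by move=> [D [pD AD DB]]; exact: (ab u v D).
- move=> dich.
  have disj : A1 `&` cantor_diag = set0.
    by apply/seteqP; split=> // -[a b] [+ ab]; rewrite (ab : a = b) => /A1_irr.
  have [[[D [pD AD DB]] _]|[_ [u [v [_ _ uA uB]]]]] :=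
    dich _ _ pC pC _ _ (A1_analytic R) (cantor_diag_analytic R) disj.
    exact: (excl _ _ A1_reindex pD AD DB).
  pose a := prepend (rcons (sn 0) false) (fun=> false).
  pose b := prepend (rcons (sn 0) true) (fun=> false).
  have ab : A1 (a, b) by exists 0, (fun=> false).
  have e1 := uB (b, a) (A1_asym ab).
  have e2 := uB (a, a) (@A1_irr a); have e3 := uB (b, b) (@A1_irr b).
  move: e1 e2 e3; rewrite /prod_map /cantor_diag /= => e1 e2 e3.
  by have /= := uA _ ab; rewrite /prod_map /= e2 -e1 e3; exact: A1_irr.
move=> dich.
have [[[D [pD AD DB]] _]|[_ [u [v [[cu uinj] _ uA uB]]]]] :=
  dich _ _ pC pC _ _ (spread_graph_analytic R) (cantor_diag_analytic R)
    spread_graph_diag.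
  exact: (excl _ _ spread_graph_bit_reindex pD AD DB).
have uv a : u a = v a := uB (a, a) (closure_A1_diag a).
apply: (spread_graph_not_inj cu _ uinj) => p /uA.
by rewrite /prod_map /= -uv.
Qed.
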